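(* Let $h\in\mathbb{Z}^d$, and let $C(h)\subseteq\Delta^n\times\mathbb{C}^d$, the integer $k$, the matrix $A=(a_{i,j})$, the matrices $M_1,\dots,M_n$, and the polynomials $p_1,\dots,p_k$ and $f_1,\dots,f_e$ be as defined in the context. Then the closure $\overline{C(h)}$ of the sheet $C(h)$ in $\Delta^n\times\mathbb{C}^d$ is an analytic subset, defined by $d+e$ holomorphic equations in the coordinates $(t_1,\dots,t_n,v_1,\dots,v_d)$. These equations are, firstly, the $d$ equations (in components) $$v=e^{-(p_1(v)M_1+\dots+p_k(v)M_k)}h,$$ and, secondly, $$f_b\Bigl(t_1e^{-2\pi i\sum_{s\le k}a_{1,s}p_s(v)},\dots,t_ne^{-2\pi i\sum_{s\le k}a_{n,s}p_s(v)}\Bigr)=0\qquad\text{for } b=1,\dots,e.$$ In particular, as the closure of the complex submanifold $C(h)$, the subset $\overline{C(h)}$ is itself a reduced and irreducible analytic space.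
   Context: $\Delta\subseteq\mathbb{C}$ is the open unit disk, $\mathbb{H}$ the upper half-plane. Let $T_1,\dots,T_n\in\mathrm{Aut}_{\mathbb{Z}}(\mathbb{Z}^d)$ be commuting unipotent matrices (the monodromy matrices of a unipotent local system on $(\Delta\setminus\{0\})^n$), and let $N_j=-\log T_j=\sum_{m\ge1}\frac1m(\mathrm{id}-T_j)^m$, which are commuting nilpotent matrices with rational entries. Let $$f\colon\mathbb{H}^n\times\mathbb{Z}^d\to\Delta^n\times\mathbb{C}^d,\quad f(z_1,\dots,z_n,h)=\bigl(e^{2\pi i z_1},\dots,e^{2\pi i z_n},\,e^{-(z_1N_1+\dots+z_nN_n)}h\bigr).$$ For $h\in\mathbb{Z}^d$, the sheet $C(h)$ is the image of $f(\,\cdot\,,h)\colon\mathbb{H}^n\to\Delta^n\times\mathbb{C}^d$. Coordinates on $\Delta^n\times\mathbb{C}^d$ are $(t,v)=(t_1,\dots,t_n,v_1,\dots,v_d)$. Fix $h$. Let $S\subseteq\mathbb{Z}^n$ be the subgroup of all $(a_1,\dots,a_n)$ with $T_1^{a_1}\cdots T_n^{a_n}h=h$ (equivalently $a_1N_1h+\dots+a_nN_nh=0$); it is free, and $k$ is defined by saying that its rank is $n-k$. The quotient $\mathbb{Z}^n/S$ is free, so one can fix an $n\times n$ integer matrix $A=(a_{i,j})$ with $\det A=1$ whose last $n-k$ columns form a basis of $S$. Put $M_j=\sum_{i=1}^n a_{i,j}N_i$; then $M_{k+1}h=\dots=M_nh=0$ and $M_1h,\dots,M_kh$ are linearly independent.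 Let $p_1(v),\dots,p_k(v)$ be polynomials in $v=(v_1,\dots,v_d)$ such that whenever $v=e^{-(w_1M_1+\dots+w_kM_k)}h$ with $(w_1,\dots,w_k)\in\mathbb{C}^k$, one has $w_s=p_s(v)$ for $s=1,\dots,k$ (such polynomials exist). Let $f_1,\dots,f_e\in\mathbb{C}[x_1,\dots,x_n]$ be finitely many polynomials whose common zero set in $\mathbb{C}^n$ is the closure of the image of the monomial map $(\mathbb{C}^{*})^{n-k}\to\mathbb{C}^n$, $(u_{k+1},\dots,u_n)\mapsto(x_1,\dots,x_n)$, $x_j=\prod_{i=k+1}^n u_i^{a_{j,i}}$ (this closure is a closed algebraic subvariety of $\mathbb{C}^n$). *)

(* Defs.v *)
From HB Require Import structures.
From mathcomp Require Import all_boot all_order all_algebra.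
From mathcomp Require Import complex.
From mathcomp Require Import all_classical all_reals all_analysis.
(* Not imported: its notations clash with those of MathComp-Analysis. *)
From mathcomp Require mpoly.

Set Implicit Arguments.
Unset Strict Implicit.
Unset Printing Implicit Defensive.

Import Order.TTheory GRing.Theory Num.Theory.
Import numFieldNormedType.Exports.

Local Open Scope classical_set_scope.
Local Open Scope ring_scope.

(* [R[i]] carries no canonical topology; packing it as a numClosedFieldType
   gives it the norm topology, and makes it a normed module over itself. *)
Definition cplx (R : realType) : numClosedFieldType := R[i].

Definition cexp (R : realType) (z : cplx R) : cplx R :=
  let: Complex a b := (z : R[i]) in Complex (expR a * cos b) (expR a * sin b).

Definition twopii (R : realType) : cplx R := Complex 0 (2 * pi).

Section AnalyticSets.
Context (R : realType) (V : normedModType (cplx R)).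
Implicit Types (Omega W X Y Z : set V) (g : V -> cplx R).

(* Differentiability is over the field [cplx R], i.e. complex (Frechet)
   differentiability; used on open sets only. *)
Definition holomorphic_on W g : Prop := forall x, W x -> differentiable g x.

Definition analytic_subset Omega X : Prop :=
  X `<=` Omega /\
  forall x, Omega x -> exists W : set V,
    [/\ open W, W x, W `<=` Omega &
      exists (m : nat) (g : 'I_m -> V -> cplx R),
        (forall i, holomorphic_on W (g i)) /\
        X `&` W = [set y | W y /\ forall i, g i y = 0]].

(* When X is analytic in Omega, the analytic subsets of the space X are the
   analytic subsets of Omega contained in X. *)
Definition irreducible_analytic Omega X : Prop :=
  [/\ analytic_subset Omega X, X !=set0 &
    forall Y Z, analytic_subset Omega Y -> analytic_subset Omega Z ->
      X = Y `|` Z -> Y = X \/ Z = X].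

Definition holomorphic_germ (x : V) g : Prop :=
  \forall y \near x, differentiable g y.

Definition vanishing_ideal X (x : V) : set (V -> cplx R) :=
  [set g | holomorphic_germ x g /\ \forall y \near x, X y -> g y = 0].

(* The local rings O_x / I_x, x in X, have no nonzero nilpotents; here I_x is
   an ideal of the ring of germs at x, given as a set of representatives. *)
Definition reduced_along X (I : V -> set (V -> cplx R)) : Prop :=
  forall x, X x -> forall g (m : nat), holomorphic_germ x g ->
    I x (fun y => g y ^+ m) -> I x g.

(* An analytic subset is an analytic space through the sheaf of restrictions
   to X of holomorphic functions, whose stalks are O_x / vanishing_ideal X x. *)
Definition reduced_analytic Omega X : Prop :=
  analytic_subset Omega X /\ reduced_along X (vanishing_ideal X).

End AnalyticSets.

Definition nilpotent_mx (K : pzRingType) (d : nat) (X : 'M[K]_d) : Prop :=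
  exists m : nat, X ^+ m = 0.

Definition unipotent_mx (K : pzRingType) (d : nat) (X : 'M[K]_d) : Prop :=
  nilpotent_mx (X - 1%:M).

Definition mxpowz (K : comUnitRingType) (d : nat) (X : 'M[K]_d) (a : int) :
    'M[K]_d :=
  match a with
  | Posz m => X ^+ m
  | Negz m => invmx X ^+ m.+1
  end.

Section MatrixExpLog.
Context (R : realType) (d : nat).
Implicit Type X : 'M[cplx R]_d.

Definition mxexp X : 'M[cplx R]_d :=
  limn (series (fun m => m`!%:R^-1 *: X ^+ m : 'M[cplx R]_d)).

(* - log X = sum_(m >= 1) (1 / m) (1 - X)^m, a finite sum for X unipotent. *)
Definition neglog X : 'M[cplx R]_d :=
  limn (series (fun m => m.+1%:R^-1 *: (1%:M - X) ^+ m.+1 : 'M[cplx R]_d)).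

End MatrixExpLog.

Section IntegerLattices.
Context (n : nat).
Implicit Type S : set 'cV[int]_n.

Definition Zbasis S (m : nat) (b : 'I_m -> 'cV[int]_n) : Prop :=
  (forall a, S a <-> exists c : 'I_m -> int, a = \sum_i c i *: b i) /\
  (forall c : 'I_m -> int, \sum_i c i *: b i = 0 -> forall i, c i = 0).

Definition free_of_rank S (m : nat) : Prop :=
  exists b : 'I_m -> 'cV[int]_n, Zbasis S b.

End IntegerLattices.

(* Indices of the first k, and of the last n - k, among n columns. *)
Definition first_ord (n k : nat) (hk : (k <= n)%N) (s : 'I_k) : 'I_n :=
  widen_ord hk s.

Definition last_ord (n k : nat) (hk : (k <= n)%N) (i : 'I_(n - k)) : 'I_n :=
  cast_ord (subnKC hk) (rshift k i).

Section Sheets.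
Context (R : realType) (n d : nat).
Local Notation C := (cplx R).
Implicit Types (T : 'I_n -> 'M[int]_d) (h : 'cV[int]_d).

Definition toC (m p : nat) (B : 'M[int]_(m, p)) : 'M[C]_(m, p) :=
  map_mx (fun a : int => a%:~R) B.

Definition upper_half : set 'rV[C]_n :=
  [set z : 'rV[C]_n | forall j, 0 < complex.Im (z 0 j : R[i])].

Definition ambient : set ('rV[C]_n * 'cV[C]_d) :=
  [set x : 'rV[C]_n * 'cV[C]_d | forall j, `|x.1 0 j| < 1].

Definition Nlog T (j : 'I_n) : 'M[C]_d := neglog (toC (T j)).

Definition sheet_map T (z : 'rV[C]_n) h : 'rV[C]_n * 'cV[C]_d :=
  (\row_j cexp (twopii R * z 0 j),
   mxexp (- \sum_j z 0 j *: Nlog T j) *m toC h).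

Definition sheet T h : set ('rV[C]_n * 'cV[C]_d) :=
  [set sheet_map T z h | z in upper_half].

(* The closure relative to the open subset [ambient]. *)
Definition sheet_closure T h : set ('rV[C]_n * 'cV[C]_d) :=
  closure (sheet T h) `&` ambient.

Definition stabilizer T h : set 'cV[int]_n :=
  [set a | (\prod_(i < n) mxpowz (T i) (a i 0)) *m h = h].

Definition Mlog T (A : 'M[int]_n) (j : 'I_n) : 'M[C]_d :=
  \sum_(i < n) (A i j)%:~R *: Nlog T i.

Section Equations.
Context (T : 'I_n -> 'M[int]_d) (h : 'cV[int]_d) (A : 'M[int]_n).
Context (k : nat) (hk : (k <= n)%N).

Definition expM (w : 'I_k -> C) : 'cV[C]_d :=
  mxexp (- \sum_(s < k) w s *: Mlog T A (first_ord hk s)) *m toC h.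

Definition monomial_image : set 'rV[C]_n :=
  [set x | exists u : 'I_(n - k) -> C, (forall i, u i != 0) /\
    x = \row_j \prod_(i < n - k) u i ^ A j (last_ord hk i)].

Definition evalp (p : 'I_k -> mpoly.mpoly d C) (v : 'cV[C]_d) (s : 'I_k) : C :=
  mpoly.meval (fun l => v l 0) (p s).

Definition eq_exp (p : 'I_k -> mpoly.mpoly d C) (l : 'I_d)
    (x : 'rV[C]_n * 'cV[C]_d) : C :=
  x.2 l 0 - expM (evalp p x.2) l 0.

Definition eq_mon (p : 'I_k -> mpoly.mpoly d C) (q : mpoly.mpoly n C)
    (x : 'rV[C]_n * 'cV[C]_d) : C :=
  mpoly.meval (fun j => x.1 0 j * cexp (- (twopii R *
      \sum_(s < k) (A j (first_ord hk s))%:~R * evalp p x.2 s))) q.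

End Equations.
End Sheets.

Arguments upper_half : clear implicits.
Arguments ambient : clear implicits.
Arguments sheet R {n d} T h.
Arguments sheet_closure R {n d} T h.
Arguments monomial_image R {n} A {k} hk.

(* Main.v *)
(* Write z = A w.  Since M_(k+1) h = ... = M_n h = 0, the second component of
   the sheet map depends on w_1, ..., w_k only, and the first one is, up to the
   factors exp (2 pi i sum_(s <= k) a_(j,s) w_s), the monomial map evaluated at
   u_i = exp (2 pi i w_i).  As w_s = p_s(v) on the sheet, the equations hold on
   it, hence on its closure; conversely a solution (t, v) with
   w_s := p_s(v) is the limit of the sheet points obtained by approximating the
   rescaled t by points of the monomial image, |t_j| < 1 being Im z_j > 0.

   If the closure is a union of two analytic subsets Y and Z, then either Y
   contains the sheet or the preimage of Z under the sheet map has an interior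
   point; by the identity theorem that interior is closed in the convex set
   H^n, so that Z contains the sheet.  The identity theorem is needed for
   functions that are only assumed complex differentiable.  It follows from the
   maximum modulus principle, and the latter from a Goursat theorem about
   Riemann sums (no integral is used): the contour sums of a grid of
   parallelograms are additive and vanish on affine functions, so bisection
   shows that they tend to 0. *)
Require Import Defs.
From HB Require Import structures.
From mathcomp Require Import all_boot all_order all_algebra.
From mathcomp Require Import complex.
From mathcomp Require Import all_classical all_reals all_analysis.
From mathcomp Require mpoly.
From mathcomp Require Import ring lra zify.
Set Implicit Arguments.
Unset Strict Implicit.
Unset Printing Implicit Defensive.
Import Order.TTheory GRing.Theory Num.Theory.
Import numFieldNormedType.Exports.
Local Open Scope classical_set_scope.
Local Open Scope ring_scope.

(** * The modulus of a complex number as a real number *)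

Section ComplexAbs.
Context (R : realType).
Local Notation C := (cplx R).
Implicit Types (z w : C) (x : R).

(* The norm of [cplx R] takes its values in [cplx R], where [lra] does not
   apply; [cabs] is the same norm with values in R. *)
Definition cabs z : R := complex.Re (`|z| : R[i]).

Definition ofR (x : R) : C := Complex x 0.

Lemma ofR_is_zmod : zmod_morphism ofR.
Proof. by move=> x y; apply/eqP; rewrite eq_complex /= oppr0 addr0 !eqxx. Qed.

Lemma ofR_is_mono : monoid_morphism ofR.
Proof.
split=> // x y; apply/eqP.
by rewrite eq_complex /= !mulr0 mul0r subr0 addr0 !eqxx.
Qed.

HB.instance Definition _ := GRing.isZmodMorphism.Build R C ofR ofR_is_zmod.
HB.instance Definition _ := GRing.isMonoidMorphism.Build R C ofR ofR_is_mono.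

Lemma normE z : `|z| = ofR (cabs z).
Proof. by rewrite /cabs /ofR; rewrite normc_def. Qed.

Lemma ofR_le x y : (ofR x <= ofR y) = (x <= y).
Proof. exact: lecR. Qed.

Lemma ofR_lt x y : (ofR x < ofR y) = (x < y).
Proof. exact: ltcR. Qed.

Lemma cabs_ge0 z : 0 <= cabs z.
Proof. by rewrite -ofR_le -normE rmorph0. Qed.

Lemma cabsD z w : cabs (z + w) <= cabs z + cabs w.
Proof. by rewrite -ofR_le rmorphD /= -!normE ler_normD. Qed.

Lemma cabsM z w : cabs (z * w) = cabs z * cabs w.
Proof. by have := normrM z w; rewrite !normE -rmorphM /= => -[]. Qed.

Lemma cabsN z : cabs (- z) = cabs z.
Proof. by rewrite /cabs normrN. Qed.

Lemma cabs0 : cabs 0 = 0.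
Proof. by rewrite /cabs normr0. Qed.

Lemma cabs1 : cabs 1 = 1.
Proof. by rewrite /cabs normr1. Qed.

Lemma cabsX z m : cabs (z ^+ m) = cabs z ^+ m.
Proof. by elim: m => [|m IH]; rewrite ?expr0 ?cabs1 // !exprS cabsM IH. Qed.

Lemma cabs_sum m (F : 'I_m -> C) : cabs (\sum_i F i) <= \sum_i cabs (F i).
Proof.
elim/big_rec2: _ => [|i y1 y2 _ H]; first by rewrite cabs0.
by rewrite (le_trans (cabsD _ _))// lerD2l.
Qed.

Lemma cabs_eq0 z : (cabs z == 0) = (z == 0).
Proof.
apply/eqP/eqP => [h|->]; last exact: cabs0.
by apply/eqP; rewrite -normr_eq0 normE h rmorph0.
Qed.

Lemma cabsV z : cabs z^-1 = (cabs z)^-1.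
Proof.
have [->|z0] := eqVneq z 0; first by rewrite invr0 cabs0 invr0.
have c0 : cabs z != 0 by rewrite cabs_eq0.
by apply: (mulfI c0); rewrite -cabsM !divff// cabs1.
Qed.

Lemma cabs_ofR x : cabs (ofR x) = `|x|.
Proof. by rewrite /cabs normc_def /= expr0n/= addr0 sqrtr_sqr. Qed.

Lemma cabs_nat m : cabs (m%:R) = m%:R.
Proof. by rewrite -(rmorph_nat ofR) cabs_ofR normr_nat. Qed.

Lemma gt0_ofR (e : C) : 0 < e -> exists2 x : R, 0 < x & e = ofR x.
Proof.
move=> e0; exists (complex.Re (e : R[i])).
  by move: e0; rewrite ltcE /= => /andP[].
by move: e0; rewrite ltcE /=; case: e => a b /= /andP[/eqP -> _].
Qed.

End ComplexAbs.

(** Multiplying the difference quotient by [h] removes the division. At [h = 0] the resulting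
    estimate is trivial, so the punctured neighbourhood can be replaced by a full one. *)
Lemma derivable_epsP (K : numFieldType) (f : K -> K) (x df : K) :
  (h^-1 *: (f (h *: 1 + x) - f x) @[h --> 0^'] --> df) <->
  forall e, 0 < e -> \forall h \near 0, `|f (h + x) - f x - h * df| <= e * `|h|.
Proof.
have E h : h != 0 -> df - h^-1 *: (f (h *: 1 + x) - f x) =
    - (h^-1 * (f (h + x) - f x - h * df)).
  by move=> h0; rewrite /GRing.scale/= mulr1 [in RHS]mulrBr mulKf// opprB.
split=> [/cvgrPdist_le H e e0|H].
  have := H e e0; rewrite near_withinE; apply: filterS => h.
  have [->|h0 /(_ isT)] := eqVneq h 0.
    by rewrite add0r subrr mul0r subr0 normr0 mulr0.
  by rewrite E// normrN normrM normfV mulrC ler_pdivrMr ?normr_gt0.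
apply/cvgrPdist_le => e e0; rewrite near_withinE.
apply: filterS (H e e0) => h Hh h0.
by rewrite E// normrN normrM normfV mulrC ler_pdivrMr ?normr_gt0.
Qed.

(** * Rules of differentiation *)

Section PointwiseDifferentiable.
Context (K : numFieldType) (V W : normedModType K).
Implicit Types (f g : V -> K) (x : V).

(* Unlike [differentiableD] and [differentiableM], which are stated with the
   ring operations on functions, these apply to goals [fun y => _]. *)
Lemma differentiable_add (f g : V -> W) x :
  differentiable f x -> differentiable g x -> differentiable (fun y => f y + g y) x.
Proof. exact: differentiableD. Qed.

Lemma differentiable_mul f g x :
  differentiable f x -> differentiable g x -> differentiable (fun y => f y * g y) x.
Proof. exact: differentiableM. Qed.

Lemma differentiable_exp f m x :
  differentiable f x -> differentiable (fun y => f y ^+ m) x.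
Proof.
move=> df; elim: m => [|m IH]; first exact: differentiable_cst.
have -> : (fun y => f y ^+ m.+1) = (fun y => f y * f y ^+ m).
  by apply/funext => y; rewrite exprS.
exact: differentiable_mul.
Qed.

Lemma differentiable_bigsum (I : Type) (r : seq I) (F : I -> V -> W) x :
  (forall i, differentiable (F i) x) -> differentiable (fun y => \sum_(i <- r) F i y) x.
Proof.
move=> dF; elim: r => [|i r IH].
  rewrite (_ : (fun y => _) = cst 0); last by apply/funext => y; rewrite big_nil.
  exact: differentiable_cst.
rewrite (_ : (fun y => _) = fun y => F i y + \sum_(j <- r) F j y); last first.
  by apply/funext => y; rewrite big_cons.
exact: differentiable_add.
Qed.

Lemma differentiable_bigprod (I : Type) (r : seq I) (F : I -> V -> K) x :
  (forall i, differentiable (F i) x) -> differentiable (fun y => \prod_(i <- r) F i y) x.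
Proof.
move=> dF; elim: r => [|i r IH].
  rewrite (_ : (fun y => _) = cst 1); last by apply/funext => y; rewrite big_nil.
  exact: differentiable_cst.
rewrite (_ : (fun y => _) = fun y => F i y * \prod_(j <- r) F j y); last first.
  by apply/funext => y; rewrite big_cons.
exact: differentiable_mul.
Qed.

Lemma differentiable_fst (x : V * W) : differentiable (fst : V * W -> V) x.
Proof.
apply: (@linear_differentiable _ _ _ (@fst V W : {linear (V * W)%type -> V})) => ?.
exact: cvg_fst.
Qed.

Lemma differentiable_snd (x : V * W) : differentiable (snd : V * W -> W) x.
Proof.
apply: (@linear_differentiable _ _ _ (@snd V W : {linear (V * W)%type -> W})) => ?.
exact: cvg_snd.
Qed.

End PointwiseDifferentiable.

Lemma differentiable_matrix (K : numFieldType) (V : normedModType K) m n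
    (f : V -> 'M[K]_(m, n)) (x : V) :
  (forall i j, differentiable (fun y => f y i j) x) -> differentiable f x.
Proof.
move=> df; rewrite (_ : f = fun y => \sum_i \sum_j f y i j *: delta_mx i j).
  apply: differentiable_bigsum => i.
  by apply: differentiable_bigsum => j; exact: differentiableZl.
by apply/funext => y; exact: matrix_sum_delta.
Qed.

(** * The complex exponential *)

Section ComplexDiff.
Context (R : realType).
Local Notation C := (cplx R).

Lemma near_cabs (z : C) (P : C -> Prop) :
  (\forall w \near z, P w) <->
  exists2 r : R, 0 < r & forall w, cabs (w - z) < r -> P w.
Proof.
split=> [/nbhs_normP[e /= /gt0_ofR[r r0 ->] H]|[r r0 H]].
  by exists r => // w wr; apply: H; rewrite /= distrC normE ofR_lt.
apply/nbhs_normP; exists (ofR r) => /=; first by rewrite -(rmorph0 (@ofR R)) ofR_lt.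
by move=> w /=; rewrite distrC normE ofR_lt; exact: H.
Qed.

(** The first-order expansion with real error bounds is the form used both for the exponential and
    at the limit point in Goursat's theorem. *)
Lemma differentiable_cabsP (f : C -> C) (z : C) :
  differentiable f z <->
  exists b : C, forall e : R, 0 < e -> exists2 r : R, 0 < r &
    forall w, cabs (w - z) < r ->
      cabs (f w - f z - (w - z) * b) <= e * cabs (w - z).
Proof.
rewrite -derivable1_diffP; split=> [|[b H]].
  move=> /cvg_ex[b /derivable_epsP H]; exists b => e e0.
  have /near_cabs[r r0 Hr] : \forall h \near (0 : C),
     `|f (h + z) - f z - h * b| <= ofR e * `|h|.
    by apply: H; rewrite -(rmorph0 (@ofR R)) ofR_lt.
  exists r => // w wr; have := Hr (w - z); rewrite subr0 subrK => /(_ wr).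
  by rewrite !normE -rmorphM ofR_le.
apply/cvg_ex; exists b; apply/derivable_epsP => _ /gt0_ofR[e e0 ->].
apply/near_cabs; have [r r0 Hr] := H e e0.
exists r => // h; rewrite subr0 => hr.
by have := Hr (h + z); rewrite addrK !normE -rmorphM ofR_le; apply.
Qed.

Lemma is_derive_near (f : R -> R) (x df : R) : is_derive x 1 f df ->
  forall e, 0 < e -> exists2 r : R, 0 < r & forall h, `|h| < r ->
   `|f (h + x) - f x - h * df| <= e * `|h|.
Proof.
move=> [+ +] e e0; rewrite /derivable => /cvg_ex[l Hl] <-.
have -> : 'D_1 f x = l by exact: cvg_lim Hl.
have /nbhs_normP[r /= r0 Hr] := (derivable_epsP f x l).1 Hl e e0.
by exists r => // h hr; apply: Hr => /=; rewrite sub0r normrN.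
Qed.

Lemma cexpD (z w : C) : cexp (z + w) = cexp z * cexp w.
Proof.
case: z w => a b [c d]; apply/eqP; rewrite eq_complex /=.
by rewrite expRD cosD sinD; apply/andP; split; apply/eqP; ring.
Qed.

Lemma cexp0 : cexp (0 : C) = 1.
Proof.
by apply/eqP; rewrite eq_complex /= expR0 cos0 sin0 !mul1r !eqxx.
Qed.

Lemma cabsE (a b : R) : cabs (Complex a b : C) = Num.sqrt (a ^+ 2 + b ^+ 2).
Proof. by rewrite /cabs normc_def. Qed.

Lemma cabs_cexp (z : C) : cabs (cexp z) = expR (complex.Re (z : R[i])).
Proof.
case: z => a b /=; rewrite cabsE !exprMn -mulrDr cos2Dsin2 mulr1.
by rewrite sqrtr_sqr gtr0_norm// expR_gt0.
Qed.

Lemma cexp_neq0 (z : C) : cexp z != 0.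
Proof. by rewrite -cabs_eq0 cabs_cexp gt_eqF// expR_gt0. Qed.

Lemma cexpN (z : C) : cexp (- z) = (cexp z)^-1.
Proof. by apply: (mulfI (cexp_neq0 z)); rewrite -cexpD subrr cexp0 divff// cexp_neq0. Qed.

Lemma cexp_sum (I : finType) (F : I -> C) :
  cexp (\sum_i F i) = \prod_i cexp (F i).
Proof. by rewrite (big_morph _ cexpD cexp0). Qed.

Lemma cexp_int (z : C) (m : int) : cexp (m%:~R * z) = cexp z ^ m.
Proof.
have H j : cexp (j%:R * z) = cexp z ^+ j.
  elim: j => [|j IH]; first by rewrite mul0r cexp0.
  by rewrite -natr1 mulrDl mul1r cexpD IH exprSr.
case: m => j; first exact: H.
by rewrite NegzE mulrNz mulNr cexpN -exprnN H.
Qed.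

Lemma cexp_periodic (z : C) : cexp (z + twopii R) = cexp z.
Proof.
have E : cexp (twopii R) = 1.
  by apply/eqP; rewrite eq_complex /= expR0 mulr_natl cos2pi sin2pi !mul1r !eqxx.
by rewrite cexpD E mulr1.
Qed.

Lemma cexp_surj (u : C) : u != 0 -> exists z, cexp z = u.
Proof.
move=> u0; have r0 : 0 < cabs u by rewrite lt_neqAle eq_sym cabs_eq0 u0 cabs_ge0.
set r := cabs u in r0; case: u u0 @r r0 => a b u0 r r0.
have re : a ^+ 2 + b ^+ 2 = r ^+ 2.
  by rewrite /r cabsE sqr_sqrtr// addr_ge0// sqr_ge0.
pose x := a / r; pose y := b / r.
have xy : x ^+ 2 + y ^+ 2 = 1.
  by rewrite /x /y !exprMn -mulrDl re exprVn divff// expf_neq0// gt_eqF.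
have x1 : -1 <= x <= 1 by apply/andP; split; nra.
suff [t ct st] : exists2 t, cos t = x & sin t = y.
  exists (Complex (ln r) t); apply/eqP; rewrite eq_complex /= lnK ?posrE// ct st.
  by rewrite /x /y !(mulrC r) !divfK ?(gt_eqF r0)// !eqxx.
have s : sin (acos x) = `|y| by rewrite sin_acos// -xy [_ + y ^+ 2]addrC addrK sqrtr_sqr.
(* [acos] yields only angles in [0, pi], so a negative imaginary part takes the opposite angle. *)
have [y0|y0] := leP 0 y.
  by exists (acos x); [exact: acosK|rewrite s ger0_norm].
exists (- acos x); first by rewrite cosN acosK.
by rewrite sinN s ltr0_norm// opprK.
Qed.

Lemma cabs_bounds (a b : R) : `|a| <= cabs (Complex a b : C) /\
  `|b| <= cabs (Complex a b : C) /\ cabs (Complex a b : C) <= `|a| + `|b|.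
Proof.
rewrite cabsE; split; last split.
- by rewrite -sqrtr_sqr ler_wsqrtr// lerDl sqr_ge0.
- by rewrite -sqrtr_sqr ler_wsqrtr// lerDr sqr_ge0.
- rewrite -[leRHS]ger0_norm ?addr_ge0// -sqrtr_sqr ler_wsqrtr//.
  rewrite sqrrD !real_normK ?num_real// lerD2r lerDl.
  by rewrite mulrn_wge0// mulr_ge0.
Qed.

(** The functional equation reduces the claim to the point 0, where the expansion follows from the
    real derivatives of exp, sin and cos. *)
Lemma differentiable_cexp (z : C) : differentiable (@cexp R) z.
Proof.
suff D0 : forall e : R, 0 < e -> exists2 r : R, 0 < r & forall h : C, cabs h < r ->
    cabs (cexp h - 1 - h) <= e * cabs h.
  apply/differentiable_cabsP; exists (cexp z) => e e0.
  have c0 : 0 < cabs (cexp z) by rewrite cabs_cexp expR_gt0.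
  have [r r0 H] := D0 (e / cabs (cexp z)) (divr_gt0 e0 c0).
  exists r => // w /H; set h := w - z => Hh.
  have -> : w = h + z by rewrite subrK.
  rewrite cexpD; have -> : cexp h * cexp z - cexp z - h * cexp z =
    (cexp h - 1 - h) * cexp z by ring.
  by rewrite cabsM -ler_pdivlMr// -mulrAC.
(* The two components of the error will be at most q(|a| + 2|b|) and 3q|b|, in total 6q times the
   modulus. The bound q <= 1 also keeps exp a <= 2. *)
move=> e e0; pose q := Num.min (e / 6) 1.
have q0 : 0 < q by rewrite lt_min ltr01 divr_gt0.
have q1 : q <= 1 by rewrite ge_min lexx orbT.
have qe : q <= e / 6 by rewrite ge_min lexx.
have [r1 r10 H1] := is_derive_near (is_derive_expR 0) q0.
have [r2 r20 H2] := is_derive_near (is_derive_sin 0) q0.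
have [r3 r30 H3] := is_derive_near (is_derive_cos 0) q0.
pose r := Num.min (q / 2) (Num.min r1 (Num.min r2 r3)).
exists r; first by rewrite !lt_min r10 r20 r30 divr_gt0.
case=> a b hr; have [ha [hb _]] := cabs_bounds a b.
have := le_lt_trans ha hr; rewrite !lt_min => /and4P[aq ar1 _ _].
have := le_lt_trans hb hr; rewrite !lt_min => /and4P[bq _ br2 br3].
move: (H1 _ ar1) (H2 _ br2) (H3 _ br3); rewrite !addr0 expR0 sin0 cos0 !mulr1 oppr0 mulr0.
rewrite !subr0 !addr0.
set A := `|a| in ha aq *; set B := `|b| in hb bq *; set M := cabs _ in ha hb *.
have A0 : 0 <= A by rewrite normr_ge0.
have B0 : 0 <= B by rewrite normr_ge0.
move=> Ea Eb Ec.
have [_ [_ E]] := cabs_bounds (expR a * cos b - 1 - a) (expR a * sin b - b).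
have -> : cexp (Complex a b) - 1 - Complex a b =
  Complex (expR a * cos b - 1 - a) (expR a * sin b - b) :> C.
  by apply/eqP; rewrite eq_complex /= oppr0 !addr0 !eqxx.
apply: le_trans E _.
have Ea1 : `|expR a - 1| <= q.
  rewrite -(subrK a (expR a - 1)); apply: le_trans (ler_normD _ _) _.
  by apply: le_trans (lerD Ea (lexx _)) _; rewrite -/A; nra.
have Ea2 : expR a <= 2 by move: Ea1; rewrite ler_norml => /andP[]; lra.
have X1 : `|expR a * cos b - 1 - a| <= 2 * (q * B) + q * A.
  have -> : expR a * cos b - 1 - a = expR a * (cos b - 1) + (expR a - 1 - a) by ring.
  apply: le_trans (ler_normD _ _) _; apply: lerD => //.
  by rewrite normrM ler_pM// gtr0_norm ?expR_gt0.
have X2 : `|expR a * sin b - b| <= 2 * (q * B) + q * B.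
  have -> : expR a * sin b - b = expR a * (sin b - b) + (expR a - 1) * b by ring.
  apply: le_trans (ler_normD _ _) _; apply: lerD => //.
    by rewrite normrM ler_pM// gtr0_norm ?expR_gt0.
  by rewrite normrM ler_pM.
apply: le_trans (lerD X1 X2) _.
have M0 : 0 <= M by rewrite cabs_ge0.
by nra.
Qed.

End ComplexDiff.

(** * Goursat's theorem for Riemann sums *)

Section DiscreteGoursat.
Context (R : realType).
Local Notation C := (cplx R).
Implicit Types (F G : C -> C) (z a b w : C) (N m j : nat).

(* Riemann sums of the contour integral over the parallelogram with sides a, b. *)
Definition edge F N z a : C := N%:R^-1 * \sum_(j < N) F (z + j%:R / N%:R * a).

(** Opposite sides are grouped: they are traversed in opposite directions, hence the differences. *)
Definition dcontour F N z a b : C :=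
  a * (edge F N z a - edge F N (z + b) a) +
  b * (edge F N (z + a) b - edge F N z b).

Lemma edge_double F N z a :
  edge F (N + N) z a =
    2^-1 * (edge F N z (2^-1 * a) + edge F N (z + 2^-1 * a) (2^-1 * a)).
Proof.
(* For [N = 0] the inverse defaults to 0, and both sides vanish. *)
have [->|N0] := posnP N; first by rewrite /edge !invr0 !mul0r addr0 mulr0.
have Nn0 : N%:R != 0 :> C by rewrite pnatr_eq0 -lt0n.
have Nn2 : N%:R + N%:R != 0 :> C by rewrite -natrD pnatr_eq0 -lt0n addn_gt0 N0.
rewrite /edge big_split_ord /= -mulrDr mulrA -invfM natrD; congr (_ * _).
  by congr (_^-1); ring.
congr (_ + _); apply: eq_bigr => i _; congr (F _).
  by field; rewrite Nn0 Nn2.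
by rewrite natrD; field; rewrite Nn0 Nn2.
Qed.

(** Each outer edge sum splits into its two halves, and every inner edge occurs in two quadrants
    with opposite signs. The additivity is thus exact for the sums, without any limit. *)
Lemma dcontour_double F N z a b (a' := 2^-1 * a) (b' := 2^-1 * b) :
  dcontour F (N + N) z a b =
    dcontour F N z a' b' + dcontour F N (z + a') a' b' +
    (dcontour F N (z + b') a' b' + dcontour F N (z + a' + b') a' b').
Proof.
have ea : a = a' + a' by rewrite /a'; field.
have eb : b = b' + b' by rewrite /b'; field.
rewrite /dcontour !edge_double -/a' -/b'.
have -> : z + a = z + a' + a' by rewrite {1}ea addrA.
have -> : z + b = z + b' + b' by rewrite {1}eb addrA.
have -> : z + b' + b' + a' = z + a' + b' + b' by ring.
have -> : z + b' + a' = z + a' + b' by ring.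
have -> : z + a' + b' + a' = z + a' + a' + b' by ring.
by rewrite {1}ea {1}eb; field.
Qed.

Lemma edgeB F G N z a :
  edge (fun w => F w - G w) N z a = edge F N z a - edge G N z a.
Proof. by rewrite /edge sumrB mulrBr. Qed.

Lemma edge_le F N z a (e : R) : 0 <= e ->
  (forall s : R, 0 <= s <= 1 -> cabs (F (z + ofR s * a)) <= e) ->
  cabs (edge F N z a) <= e.
Proof.
move=> e0 H; rewrite /edge cabsM cabsV cabs_nat.
have [->|N0] := posnP N; first by rewrite invr0 mul0r.
rewrite mulrC ler_pdivrMr ?ltr0n//; apply: le_trans (cabs_sum _) _.
have -> : e * N%:R = \sum_(i < N) e by rewrite sumr_const card_ord mulr_natr.
apply: ler_sum => i _.
have -> : i%:R / N%:R = ofR (i%:R / N%:R) :> C by rewrite rmorphM fmorphV !rmorph_nat.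
apply: H; rewrite divr_ge0//= ler_pdivrMr ?ltr0n// mul1r ler_nat.
exact: ltnW.
Qed.

(** An affine function differs by a constant between opposite sides. The contributions - a b d and b
    a d of the two pairs of sides then cancel in [dcontour]. *)
Lemma edge_affine (c d : C) N z a b : (0 < N)%N ->
  edge (fun w => c + w * d) N z a - edge (fun w => c + w * d) N (z + b) a = - (b * d).
Proof.
move=> N0; rewrite -mulrBr -sumrB.
have Nn0 : N%:R != 0 :> C by rewrite pnatr_eq0 -lt0n.
rewrite (eq_bigr (fun=> - (b * d))); last by move=> i _; ring.
by rewrite sumr_const card_ord -(mulr_natl (- _)) mulKf.
Qed.

(** Subtracting an affine function leaves the contour sum unchanged, so only the deviation from it
    counts, once on each of the four sides. *)
Lemma dcontour_le F N z a b (c d : C) (e : R) : (0 < N)%N -> 0 <= e ->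
  (forall s t : R, 0 <= s <= 1 -> 0 <= t <= 1 ->
     cabs (F (z + ofR s * a + ofR t * b) - (c + (z + ofR s * a + ofR t * b) * d)) <= e) ->
  cabs (dcontour F N z a b) <= 2 * (cabs a + cabs b) * e.
Proof.
move=> N0 e0 H; pose G w := F w - (c + w * d).
have b0 : (0 : R) <= (0 : R) <= (1 : R) by rewrite lexx ler01.
have b1 : (0 : R) <= (1 : R) <= (1 : R) by rewrite lexx ler01.
have E : dcontour F N z a b = dcontour G N z a b.
  rewrite /dcontour !edgeB.
  have := edge_affine c d z a b N0; have := edge_affine c d z b a N0.
  set u := edge _ N z b; set v := edge _ N (z + a) b.
  set u' := edge _ N z a; set v' := edge _ N (z + b) a => h1 h2.
  have -> : u = v - a * d by rewrite -h1 addrCA subrr addr0.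
  have -> : u' = v' - b * d by rewrite -h2 addrCA subrr addr0.
  ring.
have Ha : forall s : R, 0 <= s <= 1 -> cabs (G (z + ofR s * a)) <= e.
  by move=> s s01; have := H s 0 s01 b0; rewrite rmorph0 mul0r addr0.
have Ha' : forall s : R, 0 <= s <= 1 -> cabs (G (z + b + ofR s * a)) <= e.
  by move=> s s01; have := H s 1 s01 b1; rewrite rmorph1 mul1r addrAC.
have Hb : forall s : R, 0 <= s <= 1 -> cabs (G (z + ofR s * b)) <= e.
  by move=> s s01; have := H 0 s b0 s01; rewrite rmorph0 mul0r addr0.
have Hb' : forall s : R, 0 <= s <= 1 -> cabs (G (z + a + ofR s * b)) <= e.
  by move=> s s01; have := H 1 s b1 s01; rewrite rmorph1 mul1r.
rewrite E /dcontour; apply: le_trans (cabsD _ _) _.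
have K (u x y : C) : cabs x <= e -> cabs y <= e -> cabs (u * (x - y)) <= cabs u * (2 * e).
  move=> hx hy; rewrite cabsM; apply: ler_wpM2l; first exact: cabs_ge0.
  apply: le_trans (cabsD _ _) _; rewrite cabsN; lra.
apply: le_trans (lerD (K _ _ _ (edge_le N e0 Ha) (edge_le N e0 Ha'))
  (K _ _ _ (edge_le N e0 Hb') (edge_le N e0 Hb))) _.
by rewrite le_eqVlt; apply/orP; left; apply/eqP; ring.
Qed.

(* The unbounded refinements of at least one quadrant keep a quarter of the
   contour sum. *)
Lemma quadrant_frequently F z a b (e : R) (a' := 2^-1 * a) (b' := 2^-1 * b) :
  (forall M, exists2 m, (M <= m)%N & e <= cabs (dcontour F (2 ^ m) z a b)) ->
  exists s t : bool, forall M, exists2 m, (M <= m)%N &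
    e / 4 <= cabs (dcontour F (2 ^ m) (z + s%:R * a' + t%:R * b') a' b').
Proof.
move=> H; apply: contrapT => /forallNP Hn.
have {}Hn (s t : bool) : exists M, forall m, (M <= m)%N ->
    cabs (dcontour F (2 ^ m) (z + s%:R * a' + t%:R * b') a' b') < e / 4.
  move: (Hn s) => /forallNP/(_ t)/existsNP[M HM]; exists M => m Mm.
  by rewrite ltNge; apply/negP => h; apply: HM; exists m.
have [M00 H00] := Hn false false; have [M10 H10] := Hn true false.
have [M01 H01] := Hn false true; have [M11 H11] := Hn true true.
(* The refinement is beyond all four thresholds even after one halving: 2^(m+1) intervals per side
   of the whole are 2^m per side of a quadrant. *)
have [m] := H (M00 + M10 + M01 + M11).+1; case: m => // m Mm.
apply/negP; rewrite -ltNge expnS mul2n -addnn dcontour_double.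
have := H00 m ltac:(lia); have := H10 m ltac:(lia).
have := H01 m ltac:(lia); have := H11 m ltac:(lia).
rewrite !(mul0r, mul1r, addr0).
rewrite -/a' -/b' => h1 h2 h3 h4.
apply: le_lt_trans (cabsD _ _) _.
have := cabsD (dcontour F (2 ^ m) z a' b') (dcontour F (2 ^ m) (z + a') a' b').
have := cabsD (dcontour F (2 ^ m) (z + b') a' b')
  (dcontour F (2 ^ m) (z + a' + b') a' b').
lra.
Qed.

Lemma half_exp_small (S r : R) : 0 <= S -> 0 < r ->
  exists j, (2^-1 : R) ^+ j * S < r.
Proof.
move=> S0 r0; exists (Num.bound (S / r)).
have := archi_boundP (divr_ge0 S0 (ltW r0)); set j := Num.bound _ => h.
rewrite exprVn mulrC ltr_pdivrMr ?exprn_gt0// mulrC -ltr_pdivrMr//.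
apply: lt_trans h _; rewrite -natrX ltr_nat; exact: ltn_expl.
Qed.

(** The intervals [x j, x j + 2^-j] are nested, and the supremum of their left ends lies in all of
    them. *)
Lemma dyadic_limit (x : nat -> R) : x 0%N = 0 ->
  (forall j, x j <= x j.+1 <= x j + 2^-1 ^+ j.+1) ->
  exists l, forall j, x j <= l <= x j + 2^-1 ^+ j.
Proof.
move=> x0 H; have up i j : (i <= j)%N -> x i <= x j.
  by move: i j; apply/nondecreasing_seqP => k; have /andP[] := H k.
have dn i j : (i <= j)%N -> x j + 2^-1 ^+ j <= x i + 2^-1 ^+ i.
  move: i j; apply/nonincreasing_seqP => k; have /andP[_] := H k.
  have : 2^-1 ^+ k.+1 = 2^-1 * 2^-1 ^+ k :> R by rewrite exprS.
  lra.
have ub i j : x i <= x j + 2^-1 ^+ j.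
  have q0 k : 0 <= 2^-1 ^+ k :> R by rewrite exprn_ge0.
  have /orP[ij|ji] := leq_total i j.
    by apply: le_trans (up _ _ ij) _; rewrite lerDl.
  by apply: le_trans (dn _ _ ji); rewrite lerDl.
have hs : has_sup (range x).
  split; first by exists (x 0%N), 0%N.
  by exists (x 0%N + 2^-1 ^+ 0) => _ [i _ <-]; exact: ub.
exists (sup (range x)) => j; apply/andP; split.
  by apply: sup_upper_bound => //; exists j.
by apply: ge_sup; [case: hs|move=> _ [i _ <-]; exact: ub].
Qed.

(** A lower bound e recurring under refinement passes to a quadrant as e / 4, and so on to a nested
    sequence. At the common point of that sequence the affine approximation makes the contour sums
    o(4^-j), a contradiction. *)
Theorem goursat F z a b :
  (forall s t : R, 0 <= s <= 1 -> 0 <= t <= 1 ->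
     differentiable F (z + ofR s * a + ofR t * b)) ->
  forall e : R, 0 < e -> exists M, forall m, (M <= m)%N ->
    cabs (dcontour F (2 ^ m) z a b) < e.
Proof.
move=> dF e e0; apply: contrapT => /forallNP Hn.
pose q j : R := 2^-1 ^+ j.
have qS j : q j.+1 = 2^-1 * q j by rewrite /q exprS.
have q0 j : 0 < q j by rewrite exprn_gt0.
(* In generation j the sides are scaled by 2^-j, and p holds the parameters of the corner. Bad means
   contour sums of at least e 4^-j for arbitrarily fine subdivisions. *)
pose bad j (p : R * R) := forall M, exists2 m, (M <= m)%N &
  e * q j ^+ 2 <= cabs (dcontour F (2 ^ m) (z + ofR p.1 * a + ofR p.2 * b)
    (ofR (q j) * a) (ofR (q j) * b)).
pose next j (p : R * R) (s : bool * bool) : R * R :=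
  (p.1 + s.1%:R * q j.+1, p.2 + s.2%:R * q j.+1).
have ofR_half : ofR (2^-1 : R) = 2^-1 by rewrite fmorphV rmorph_nat.
(* A bad quadrant of every bad parallelogram; the choice is arbitrary for the others. *)
have /choice[g Hg] : forall jp : nat * (R * R), exists s,
    bad jp.1 jp.2 -> bad jp.1.+1 (next jp.1 jp.2 s).
  move=> [j p] /=.
  have [|nb] := pselect (bad j p); last by exists (true, true).
  move=> /quadrant_frequently[s [t H]]; exists (s, t) => _ M.
  have [m Mm hm] := H M; exists m => //=; rewrite !rmorphD !rmorphM /= !rmorph_nat qS.
  rewrite rmorphM /= ofR_half -!(mulrA 2^-1).
  apply: le_trans (le_trans hm _); last first.
    rewrite le_eqVlt; apply/orP; left; apply/eqP; congr (cabs (dcontour _ _ _ _ _)).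
    ring.
  by rewrite le_eqVlt; apply/orP; left; apply/eqP; field.
pose pp := fix pp j : R * R := if j is i.+1 then next i (pp i) (g (i, pp i)) else (0, 0).
have badp j : bad j (pp j).
  elim: j => [|j IH]; last exact: (Hg (j, pp j)).
  move=> M; have /existsNP[m /not_implyP[Mm /negP]] := Hn M.
  rewrite -leNgt => h; exists m => //=; rewrite rmorph0 !mul0r !addr0 /q expr0.
  by rewrite rmorph1 !mul1r expr1n mulr1.
have bq (u : bool) j : 0 <= u%:R * q j.+1 <= q j.+1.
  by case: u; rewrite ?mul1r ?mul0r ?lexx ltW ?q0.
have [x Hx] : exists l, forall j, (pp j).1 <= l <= (pp j).1 + q j.
  by apply: dyadic_limit => // j /=; rewrite lerDl lerD2l.
have [y Hy] : exists l, forall j, (pp j).2 <= l <= (pp j).2 + q j.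
  by apply: dyadic_limit => // j /=; rewrite lerDl lerD2l.
have := Hx 0%N; have := Hy 0%N; rewrite /= /q expr0 add0r => y01 x01.
pose S := cabs a + cabs b.
have S0 : 0 <= S by rewrite addr_ge0 ?cabs_ge0.
have /differentiable_cabsP[d Hd] := dF _ _ x01 y01.
set w := z + _ + _ in Hd.
(* The contour sum in generation j will be at most 2 e' (q j)^2 S^2, which this constant puts below
   e (q j)^2. Taking S + 1 keeps the denominator positive when S = 0. *)
pose e' := e / (4 * (S + 1) ^+ 2).
have S1 : 0 < (S + 1) ^+ 2 by rewrite exprn_gt0// ltr_wpDl.
have e'0 : 0 < e' by rewrite divr_gt0// mulr_gt0.
have ee : e' * (4 * (S + 1) ^+ 2) = e by rewrite divfK// gt_eqF// mulr_gt0.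
have [r r0 Hr] := Hd e' e'0.
have [j jr] := half_exp_small S0 r0; rewrite -/(q j) in jr.
have [m _] := badp j 0%N; apply/negP; rewrite -ltNge.
have qj := q0 j.
apply: le_lt_trans
  (dcontour_le (c := F w - w * d) (d := d) (e := e' * (q j * S)) _ _ _) _.
- by rewrite expn_gt0.
- by rewrite mulr_ge0 ?(ltW e'0)// mulr_ge0 ?(ltW qj).
- move=> s t s01 t01; set v := _ + _ + ofR t * _.
  have vw : v - w = ofR ((pp j).1 + s * q j - x) * a + ofR ((pp j).2 + t * q j - y) * b.
    by rewrite /v /w !rmorphB !rmorphD !rmorphM /=; ring.
  have hvw : cabs (v - w) <= q j * S.
    rewrite vw; apply: le_trans (cabsD _ _) _; rewrite !cabsM !cabs_ofR mulrDr.
    have /andP[x1 x2] := Hx j; have /andP[y1 y2] := Hy j.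
    move: s01 t01 => /andP[s0 s1] /andP[t0 t1].
    apply: lerD; (apply: ler_wpM2r; first exact: cabs_ge0); rewrite ler_norml; nra.
  have := Hr v (le_lt_trans hvw jr).
  have -> : F v - F w - (v - w) * d = F v - (F w - w * d + v * d) by ring.
  by move/le_trans; apply; rewrite ler_wpM2l// ltW.
- rewrite !cabsM !cabs_ofR gtr0_norm// -mulrDr -/S -ee.
  have -> : 2 * (q j * S) * (e' * (q j * S)) = (e' * q j ^+ 2) * (2 * S ^+ 2) by ring.
  have lt : 2 * S ^+ 2 < 4 * (S + 1) ^+ 2 by nra.
  by rewrite [ltRHS]mulrAC ltr_pM2l// mulr_gt0// exprn_gt0.
Qed.

End DiscreteGoursat.

(** * Maximum modulus and the identity theorem *)

Section IdentityTheorem.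
Context (R : realType).
Local Notation C := (cplx R).
Implicit Types (f g : C -> C) (a z w : C).

Lemma cabs_twopii : cabs (twopii R) = 2 * pi.
Proof.
by rewrite cabsE expr0n/= add0r sqrtr_sqr ger0_norm// mulr_ge0// pi_ge0.
Qed.

Lemma edge_cst (c : C) N z a : (0 < N)%N -> edge (fun=> c) N z a = c.
Proof.
move=> N0; have Nn0 : N%:R != 0 :> C by rewrite pnatr_eq0 -lt0n.
by rewrite /edge sumr_const card_ord -(mulr_natl c) mulKf.
Qed.

(* The logarithm unrolls the punctured disc into a half-strip, on which
   Goursat's theorem compares the means over the unit circle and over a small
   circle: the two horizontal sides cancel by periodicity. *)
Lemma mean_value_le g (M : R) :
  (forall z, cabs z <= 1 -> differentiable g z) ->
  (forall z, cabs z = 1 -> cabs (g z) <= M) -> cabs (g 0) <= M.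
Proof.
move=> dg gM; rewrite leNgt; apply/negP => Mg.
have M0 : 0 <= M by apply: le_trans (cabs_ge0 _) (gM 1 _); rewrite cabs1.
(* A third of the gap: the mean over the small circle is within e of g 0 and the mean over the unit
   circle is at most M in modulus. The two means therefore differ by at least 2e, while Goursat's
   theorem makes them differ by less than e. *)
pose e := (cabs (g 0) - M) / 3.
have e0 : 0 < e by rewrite divr_gt0// subr_gt0.
have [r r0 Hr] : exists2 r : R, 0 < r &
    forall z, cabs (z - 0) < r -> cabs (g z - g 0) < e.
  apply/near_cabs; have /differentiable_continuous cg : differentiable g 0.
    by apply: dg; rewrite cabs0 ler01.
  have /cvgrPdist_lt/(_ (ofR e)) := cg; rewrite -(rmorph0 (@ofR R)) ofR_lt => /(_ e0).
  by apply: filterS => z; rewrite distrC normE ofR_lt.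
pose r' := Num.min r 1 / 2.
have r'0 : 0 < r' by rewrite divr_gt0// lt_min r0 ltr01.
have r'r : r' < r by rewrite /r' ltr_pdivrMr// gt_min ltr_pMr// ltr1n.
have r'1 : r' <= 1 by rewrite /r' ler_pdivrMr// ge_min mul1r ler1n orbT.
pose L := - ln r'; have L0 : 0 <= L by rewrite oppr_ge0 ln_le0.
pose F := g \o @cexp R.
have twopi0 : 0 < 2 * (pi : R) by rewrite mulr_gt0// pi_gt0.
(* The side s = 0 of the strip goes to the circle of radius [r'], the side s = 1 to the unit
   circle. *)
have disc (s t : R) : s <= 1 ->
    cabs (cexp (ofR (- L) + ofR s * ofR L + ofR t * twopii R)) = expR (- L * (1 - s)).
  move=> s1; rewrite cabs_cexp /=; congr expR; ring.
have dF (s t : R) : 0 <= s <= 1 -> 0 <= t <= 1 ->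
    differentiable F (ofR (- L) + ofR s * ofR L + ofR t * twopii R).
  move=> /andP[s0 s1] _; apply: differentiable_comp; first exact: differentiable_cexp.
  by apply: dg; rewrite disc// expR_le1 mulNr oppr_le0 mulr_ge0// subr_ge0.
have [m /(_ m (leqnn m))] := goursat dF (mulr_gt0 twopi0 e0).
apply/negP; rewrite -leNgt; set N := (2 ^ m)%N; have N0 : (0 < N)%N by rewrite expn_gt0.
have Fp w : F (w + twopii R) = F w by rewrite /F /= cexp_periodic.
have -> : dcontour F N (ofR (- L)) (ofR L) (twopii R) =
    twopii R * (edge F N 0 (twopii R) - edge F N (ofR (- L)) (twopii R)).
  rewrite /dcontour.
  have -> : edge F N (ofR (- L) + twopii R) (ofR L) = edge F N (ofR (- L)) (ofR L).
    by rewrite /edge; congr (_ * _); apply: eq_bigr => i _; rewrite addrAC Fp.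
  by rewrite subrr mulr0 add0r -rmorphD addNr rmorph0.
rewrite cabsM cabs_twopii ler_pM2l//.
have E1 : cabs (edge F N 0 (twopii R)) <= M.
  apply: edge_le => // s _; apply: gM.
  have := disc 1 s (lexx 1).
  by rewrite rmorph1 mul1r -rmorphD addNr rmorph0 subrr mulr0 expR0.
have E2 : cabs (edge F N (ofR (- L)) (twopii R) - g 0) <= e.
  rewrite -{1}(edge_cst (g 0) (ofR (- L)) (twopii R) N0) -edgeB.
  apply: edge_le => [|s _]; first exact: ltW.
  apply/ltW/Hr; have := disc 0 s ler01.
  by rewrite rmorph0 mul0r addr0 !subr0 mulr1 => ->; rewrite /L opprK lnK.
have := cabsD (edge F N 0 (twopii R) - edge F N (ofR (- L)) (twopii R)
   + (edge F N (ofR (- L)) (twopii R) - g 0)) (- edge F N 0 (twopii R)).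
have := cabsD (edge F N 0 (twopii R) - edge F N (ofR (- L)) (twopii R))
   (edge F N (ofR (- L)) (twopii R) - g 0).
have -> : edge F N 0 (twopii R) - edge F N (ofR (- L)) (twopii R)
   + (edge F N (ofR (- L)) (twopii R) - g 0) - edge F N 0 (twopii R) = - g 0 by ring.
rewrite !cabsN; have : cabs (g 0) = 3 * e + M by rewrite /e; field.
lra.
Qed.

Lemma cabs_sqr (x y : R) : cabs (Complex x y : C) ^+ 2 = x ^+ 2 + y ^+ 2.
Proof. by rewrite cabsE sqr_sqrtr// addr_ge0// sqr_ge0. Qed.

(** A disc automorphism preserving the unit circle carries the estimate at the centre to the point
    a. *)
Lemma maximum_modulus g (M : R) a :
  (forall z, cabs z <= 1 -> differentiable g z) ->
  (forall z, cabs z = 1 -> cabs (g z) <= M) -> cabs a < 1 -> cabs (g a) <= M.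
Proof.
move=> dg gM a1; pose a' : C := conjc (a : R[i]).
(* The automorphism of the unit disc taking 0 to a. *)
pose phi z : C := (z + a) / (1 + a' * z).
(* The sign of the right-hand side shows both that [phi] maps the closed disc into itself and that
   it preserves the unit circle. *)
have ida z : cabs (1 + a' * z) ^+ 2 - cabs (z + a) ^+ 2 =
    (1 - cabs a ^+ 2) * (1 - cabs z ^+ 2).
  rewrite /a'; case: (a) z => a1' a2 [z1 z2] /=; rewrite !cabs_sqr; ring.
have a'1 : cabs a' = cabs a by rewrite /a'; case: (a) => x y; rewrite !cabsE sqrrN.
have nz z : cabs z <= 1 -> 1 + a' * z != 0.
  move=> z1; apply/negP => /eqP /(canRL (addKr _)); rewrite addr0 => h.
  have : cabs (a' * z) = 1 by rewrite h cabsN cabs1.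
  by rewrite cabsM a'1; have := cabs_ge0 z; have := cabs_ge0 a; nra.
have phiE z : cabs z <= 1 -> cabs (phi z) <= 1 /\ (cabs z = 1 -> cabs (phi z) = 1).
  move=> z1; have := ida z; rewrite /phi cabsM cabsV.
  have d0 : 0 < cabs (1 + a' * z) by rewrite lt_neqAle eq_sym cabs_eq0 nz// cabs_ge0.
  have := cabs_ge0 z; have := cabs_ge0 a; have := cabs_ge0 (z + a) => h1 h2 h3 h4.
  have sq0 x : 0 <= x -> x <= 1 -> 0 <= 1 - x ^+ 2 :> R by move=> x0 x1; nra.
  have sa := sq0 _ h2 (ltW a1); have sz := sq0 _ h3 z1.
  split=> [|z1'].
    rewrite ler_pdivrMr// mul1r -ler_sqr ?nnegrE// ?(ltW d0)//.
    by have := mulr_ge0 sa sz; rewrite -h4 subr_ge0.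
  rewrite (_ : cabs (z + a) = cabs (1 + a' * z)) ?divff ?(gt_eqF d0)//.
  apply/eqP; rewrite -(eqrXn2 (n := 2))// ?(ltW d0)//.
  by rewrite eq_sym -subr_eq0 h4 z1' expr1n subrr mulr0.
have -> : g a = (g \o phi) 0 by rewrite /phi /= mulr0 addr0 add0r divr1.
apply: mean_value_le => [z z1|z z1]; last first.
  by apply: gM; apply: (phiE z _).2; rewrite ?z1.
apply: differentiable_comp; last by apply: dg; case: (phiE z z1).
apply: differentiable_mul; first exact: differentiable_add.
apply: differentiableV; last exact: nz.
by apply: differentiable_add => //; apply: differentiable_mul.
Qed.

Lemma exp_small (q B r : R) : 0 <= q < 1 -> 0 < r -> exists m, q ^+ m * B < r.
Proof.
move=> /andP[q0 q1] r0.
have : (q ^+ m * B) @[m --> \oo] --> 0 * B.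
  by apply: cvgMl; apply: cvg_expr; rewrite ger0_norm.
rewrite mul0r => /cvgrPdist_lt/(_ r r0)[m _ /(_ m (leqnn m))] /=.
by rewrite sub0r normrN => h; exists m; apply: le_lt_trans (ler_norm _) h.
Qed.

(* Maximum modulus for [f z / z ^+ m] gives |f a| <= B |a|^m for all m. *)
Theorem vanishing_disc f (B r : R) a : 0 < r ->
  (forall z, cabs z <= 1 -> differentiable f z) ->
  (forall z, cabs z <= 1 -> cabs (f z) <= B) ->
  (forall z, cabs z < r -> f z = 0) -> cabs a < 1 -> f a = 0.
Proof.
move=> r0 df fB f0 a1; have [->|an0] := eqVneq a 0; first by rewrite f0 ?cabs0.
apply/eqP; rewrite -cabs_eq0 eq_le cabs_ge0 andbT leNgt; apply/negP => fa.
have ca : 0 < cabs a by rewrite lt_neqAle eq_sym cabs_eq0 an0 cabs_ge0.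
have [|m] := @exp_small (cabs a) B _ _ fa; first by rewrite cabs_ge0.
apply/negP; rewrite -leNgt mulrC -ler_pdivrMr ?exprn_gt0//.
pose g z := f z * z^-1 ^+ m.
suff : cabs (g a) <= B by rewrite /g cabsM cabsX cabsV exprVn.
apply: maximum_modulus => // [z z1|z z1]; last first.
  by rewrite /g cabsM cabsX cabsV z1 invr1 expr1n mulr1; apply: fB; rewrite z1.
have [z0|z0] := eqVneq z 0; last first.
  apply: differentiable_mul; first exact: df.
  by apply: differentiable_exp; apply: differentiableV.
(* Near 0 the factor [f] vanishes, so the quotient is constantly 0 there, whatever the default value
   of the inverse at 0. *)
have : {near z, (cst 0 : C -> C) =1 g}.
  apply/near_cabs; exists r => // w; rewrite z0 subr0 => wr.
  by rewrite /g f0// mul0r.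
move=> E; apply/derivable1_diffP; apply: (near_eq_derivable E).
exact/derivable1_diffP/differentiable_cst.
Qed.

End IdentityTheorem.

(** * Nilpotent and unipotent matrices *)

Lemma big_ord_eq0_above (V : nmodType) (F : nat -> V) (a b : nat) :
  (forall m, (a <= m)%N -> F m = 0) -> (forall m, (b <= m)%N -> F m = 0) ->
  \sum_(m < a) F m = \sum_(m < b) F m.
Proof.
have H c e : (c <= e)%N -> (forall m, (c <= m)%N -> F m = 0) ->
    \sum_(m < c) F m = \sum_(m < e) F m.
  move=> ce F0; rewrite -!(big_mkord xpredT F) [RHS](big_cat_nat (leq0n c) ce)/=.
  rewrite [X in _ + X]big_nat [X in _ + X]big1 ?addr0// => m /andP[cm _].
  exact: F0.
by move=> Fa Fb; have [/H|/ltnW/H] := leqP a b => ->.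
Qed.

Section CommutingFamilies.
Context (A : pzRingType).
Implicit Types (x y : A).

(** Every term of the binomial expansion contains x to a power at least a or y to a power above
    b. *)
Lemma nilpotent_add x y a b : GRing.comm x y ->
  x ^+ a = 0 -> y ^+ b.+1 = 0 -> (x + y) ^+ (a + b).+1 = 0.
Proof.
move=> xy xa yb; rewrite exprDn_comm// big1// => i _.
have [ib|bi] := leqP i b; last by rewrite -(subnKC bi) exprD yb mul0r mulr0 mul0rn.
have -> : ((a + b).+1 - i = a + ((a + b).+1 - i - a))%N by lia.
by rewrite exprD xa !mul0r mul0rn.
Qed.

Lemma nilpotent_sum (I : Type) (r : seq I) (F : I -> A) (K : nat) :
  (forall i j, GRing.comm (F i) (F j)) -> (forall i, F i ^+ K = 0) ->
  (\sum_(i <- r) F i) ^+ (size r * K).+1 = 0.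
Proof.
move=> cF nF; elim: r => [|i r IH]; first by rewrite big_nil expr1.
rewrite big_cons mulSn; apply: nilpotent_add => //.
by apply: commr_sum => j _; exact: cF.
Qed.

End CommutingFamilies.

(** * Powers of a unipotent matrix as polynomials in the exponent *)

Section MatrixPolynomials.
Context (K : numFieldType) (d : nat).
Implicit Types (U V W X Y L : 'M[K]_d).

Lemma expr_mulmx_add X Y (h : 'cV[K]_d) m : GRing.comm X Y -> Y *m h = 0 ->
  (X + Y) ^+ m *m h = X ^+ m *m h.
Proof.
move=> XY Yh; elim: m => [|m IH]; first by rewrite !expr0.
rewrite !exprS -!mulmxE -!mulmxA IH mulmxDl [Y *m _]mulmxA.
by rewrite -[Y *m X ^+ m]/(Y * X ^+ m) (commrX m (commr_sym XY)) -mulmxE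
  -mulmxA Yh mulmx0 addr0.
Qed.

Lemma power_sum_mulmx_add X Y (h : 'cV[K]_d) (c : nat -> K) k :
  GRing.comm X Y -> Y *m h = 0 ->
  (\sum_(m < k) c m *: (X + Y) ^+ m) *m h = (\sum_(m < k) c m *: X ^+ m) *m h.
Proof.
move=> XY Yh; rewrite !mulmx_suml; apply: eq_bigr => m _.
by rewrite -!scalemxAl expr_mulmx_add.
Qed.

(* [U ^+ N] is polynomial in N; for U unipotent the coefficient L of N is
   log U, and additivity of the logarithm becomes the product rule. *)
Definition power_poly U L : Prop := exists P : 'M[{poly K}]_d,
  (forall N : nat, map_mx (horner_eval N%:R) P = U ^+ N) /\
  map_mx (coefp 1) P = L.

Lemma power_poly1 : power_poly 1 0.
Proof.
exists 1%:M; split=> [N|]; first by rewrite map_mx1 expr1n.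
apply/matrixP => i j; rewrite !mxE.
by case: eqP => _; rewrite ?coefp1 ?mulr1n ?mulr0n /= ?coef1 ?coef0.
Qed.

Lemma power_polyM U1 U2 L1 L2 : GRing.comm U1 U2 ->
  power_poly U1 L1 -> power_poly U2 L2 -> power_poly (U1 * U2) (L1 + L2).
Proof.
move=> cU [P1 [e1 l1]] [P2 [e2 l2]]; exists (P1 *m P2); split=> [N|].
  by rewrite map_mxM /= e1 e2 exprMn_comm.
(* The value at N = 0 is the zeroth power, so the constant coefficient is the identity. *)
have c0 (P : 'M[{poly K}]_d) (U : 'M[K]_d) :
    (forall N : nat, map_mx (horner_eval N%:R) P = U ^+ N) ->
    map_mx (coefp 0) P = 1%:M.
  move=> e; rewrite -[RHS](expr0 U) -(e 0%N).
  by apply/matrixP => i j; rewrite !mxE /= -horner_coef0.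
have -> : L1 + L2 = map_mx (coefp 1) P1 *m map_mx (coefp 0) P2 +
    map_mx (coefp 0) P1 *m map_mx (coefp 1) P2.
  by rewrite (c0 _ _ e1) (c0 _ _ e2) mulmx1 mul1mx l1 l2.
apply/matrixP => i j; rewrite !mxE raddf_sum -big_split /=; apply: eq_bigr => l _.
by rewrite coefM big_ord_recr big_ord1 /= !mxE addrC.
Qed.

Lemma power_polyX U L m : power_poly U L -> power_poly (U ^+ m) (m%:R *: L).
Proof.
move=> h; elim: m => [|m IH]; first by rewrite expr0 scale0r; exact: power_poly1.
rewrite exprS -nat1r scalerDl scale1r.
by apply: power_polyM => //; exact: commrX.
Qed.

Lemma power_poly_prod (I : Type) (r : seq I) (U L : I -> 'M[K]_d) :
  (forall i j, GRing.comm (U i) (U j)) -> (forall i, power_poly (U i) (L i)) ->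
  power_poly (\prod_(i <- r) U i) (\sum_(i <- r) L i).
Proof.
move=> cU h; elim: r => [|i r IH]; first by rewrite !big_nil; exact: power_poly1.
by rewrite !big_cons; apply: power_polyM => //; apply: commr_prod.
Qed.

Lemma poly_nat_eq0 (q : {poly K}) : (forall N : nat, q.[N%:R] = 0) -> q = 0.
Proof.
move=> q0; apply: (@roots_geq_poly_eq0 _ q [seq i%:R | i <- iota 0 (size q)]).
- by apply/allP => _ /mapP[i _ ->]; rewrite rootE q0.
- by rewrite map_inj_uniq ?iota_uniq//; move=> i j /eqP; rewrite eqr_nat => /eqP.
- by rewrite size_map size_iota.
Qed.

(** The difference of the two exponent polynomials, applied to [h], vanishes at all natural numbers,
    hence identically; in particular its linear coefficient is 0. *)
Lemma power_poly_vec U V LU LV (h : 'cV[K]_d) :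
  power_poly U LU -> power_poly V LV ->
  (forall N, U ^+ N *m h = V ^+ N *m h) -> LU *m h = LV *m h.
Proof.
move=> [P [eP <-]] [Q [eQ <-]] E.
pose q i := \sum_j (P i j - Q i j) * (h j 0)%:P.
have q0 i : q i = 0.
  apply: poly_nat_eq0 => N; rewrite horner_sum.
  have /matrixP/(_ i 0) := E N; rewrite -eP -eQ !mxE => /eqP.
  rewrite -subr_eq0 -sumrB => /eqP H; rewrite -[RHS]H; apply: eq_bigr => j _.
  by rewrite !mxE hornerM hornerD hornerN hornerC mulrBl.
apply/matrixP => i j; rewrite ord1 !mxE; apply/eqP; rewrite -subr_eq0 -sumrB.
apply/eqP; have : (q i)`_1 = 0 by rewrite q0 coef0.
rewrite /q coef_sum => H; rewrite -[RHS]H; apply: eq_bigr => l _.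
by rewrite !mxE /= coefMC coefB mulrBl.
Qed.

(* The polynomial (-1)^m 'X ('X - 1) ... ('X - m + 1) / m! of [horner_binpoly]. *)
Fixpoint binpoly m : {poly K} :=
  if m is i.+1 then i.+1%:R^-1 *: ((i%:R%:P - 'X) * binpoly i) else 1.

Lemma binpolyS m :
  binpoly m.+1 = m.+1%:R^-1 *: ((m%:R%:P - 'X) * binpoly m).
Proof. by []. Qed.

Lemma horner_binpoly m N : (binpoly m).[N%:R] = (-1) ^+ m * 'C(N, m)%:R.
Proof.
elim: m => [|m IH]; first by rewrite hornerC bin0 mulr1.
rewrite hornerZ hornerM hornerD hornerN hornerX hornerC IH.
have [Nm|mN] := ltnP N m.
  by rewrite !bin_small ?mulr0// ltnW.
have := mul_bin_left N m => /(congr1 (fun x => x%:R : K)).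
rewrite !natrM natrB// => H.
have m0 : m.+1%:R != 0 :> K by rewrite pnatr_eq0.
apply: (mulfI m0); rewrite mulrA divff// mul1r.
transitivity (- (-1) ^+ m * (m.+1%:R * 'C(N, m.+1)%:R) : K).
  by rewrite H; ring.
by rewrite exprS; ring.
Qed.

Lemma coef0_binpoly m : (binpoly m)`_0 = (m == 0%N)%:R.
Proof.
rewrite -horner_coef0 -[0]/(0%:R) horner_binpoly; case: m => [|m].
  by rewrite bin0 mulr1.
by rewrite bin0n mulr0.
Qed.

Lemma coef1_binpoly m : (binpoly m.+1)`_1 = - m.+1%:R^-1.
Proof.
elim: m => [|m IH].
  by rewrite binpolyS coefZ /= mulr1 coefB coefX coefC /= sub0r invr1 mul1r.
rewrite binpolyS coefZ coefM big_ord_recr big_ord1 IH coef0_binpoly /=.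
rewrite mulr0 addr0 coefB coefC coefX /= subr0.
have m0 : m.+1%:R != 0 :> K by rewrite pnatr_eq0.
by rewrite mulrN divff// mulrN1.
Qed.

(** Writing U = 1 - X, the binomial coefficients in (1 - X)^N are polynomials in N, and the linear
    coefficient of (-1)^m C(N, m) is - 1 / m for m > 0. *)
Lemma power_poly_unipotent U k : (1 - U) ^+ k = 0 ->
  power_poly U (- \sum_(m < k) m.+1%:R^-1 *: (1 - U) ^+ m.+1).
Proof.
set X := 1 - U => Xk.
have X0 m : (k <= m)%N -> X ^+ m = 0 by move=> km; rewrite -(subnKC km) exprD Xk mul0r.
exists (\matrix_(i, j) \sum_(m < k.+1) (X ^+ m) i j *: binpoly m); split=> [N|].
  have -> : U = 1 - X by rewrite /X opprB addrC subrK.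
  rewrite exprBn_comm; last exact/commr_sym/commr1.
  apply/matrixP => i j; rewrite !mxE /= /horner_eval horner_sum summxE.
  pose t m : K := (-1) ^+ m * 'C(N, m)%:R * (X ^+ m) i j.
  rewrite (eq_bigr (fun m : 'I_k.+1 => t m)); last first.
    by move=> m _; rewrite hornerZ horner_binpoly mulrC.
  rewrite [RHS](eq_bigr (fun m : 'I_N.+1 => t m)); last first.
    move=> m _; rewrite expr1n mulr1 /t.
    have -> : (-1) ^+ m * X ^+ m = (-1) ^+ m *: X ^+ m.
      by rewrite -signr_odd mulr_sign -[in RHS]signr_odd scaler_sign.
    by rewrite mulmxnE mxE -mulr_natr; ring.
  (* One sum stops by nilpotency of X, the other because C(N, m) = 0 for m > N. *)
  apply: big_ord_eq0_above => m km; rewrite /t; first by rewrite X0 ?mxE ?mulr0// ltnW.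
  by rewrite bin_small// mulr0 mul0r.
apply/matrixP => i j; rewrite !mxE /= summxE coef_sum.
rewrite big_ord_recl /= coefZ coefC mulr0 add0r.
rewrite -sumrN; apply: eq_bigr => m _.
by rewrite coefZ [_`_1]coef1_binpoly mxE mulrN mulrC.
Qed.

End MatrixPolynomials.

(** * Exponential and logarithm series that are finite sums *)

Section NilpotentSeries.
Context (R : realType) (d : nat).
Local Notation C := (cplx R).
Implicit Types (X Y U : 'M[C]_d).

Lemma lim_series_eventually0 (u : nat -> 'M[C]_d) k :
  (forall m, (k <= m)%N -> u m = 0) -> limn (series u) = \sum_(m < k) u m.
Proof.
move=> u0; apply: lim_near_cst; first exact: norm_hausdorff.
exists k => // m /= km; rewrite /series /= -(big_mkord xpredT u).
rewrite (big_cat_nat (leq0n k) km)/= [X in _ + X]big_nat [X in _ + X]big1 ?addr0//.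
by move=> i /andP[ki _]; exact: u0.
Qed.

Lemma expr_ge_eq0 X k m : X ^+ k = 0 -> (k <= m)%N -> X ^+ m = 0.
Proof. by move=> Xk km; rewrite -(subnKC km) exprD Xk mul0r. Qed.

Lemma mxexpE X k : X ^+ k = 0 -> mxexp X = \sum_(m < k) m`!%:R^-1 *: X ^+ m.
Proof.
move=> Xk; apply: lim_series_eventually0 => m km.
by rewrite (expr_ge_eq0 Xk km) scaler0.
Qed.

Lemma neglogE U k : (1 - U) ^+ k = 0 ->
  neglog U = \sum_(m < k) m.+1%:R^-1 *: (1 - U) ^+ m.+1.
Proof.
move=> Xk; apply: lim_series_eventually0 => m km.
by rewrite (expr_ge_eq0 Xk (leqW km)) scaler0.
Qed.

Lemma comm_scale X Y (c : C) : GRing.comm X Y -> GRing.comm X (c *: Y).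
Proof.
by rewrite /GRing.comm => XY; rewrite -!mulmxE -scalemxAr -scalemxAl !mulmxE XY.
Qed.

Lemma expr_scale X (c : C) m : (c *: X) ^+ m = c ^+ m *: X ^+ m.
Proof.
elim: m => [|m IH]; first by rewrite !expr0 scale1r.
by rewrite !exprS IH -!mulmxE -scalemxAr -scalemxAl scalerA mulrC.
Qed.

(** [Y] can be moved past the powers of [X] to the vector, which it kills. This is how M_(k+1), ...,
    M_n leave the exponent. *)
Lemma mxexp_mulmx_add X Y (h : 'cV[C]_d) k : GRing.comm X Y -> Y *m h = 0 ->
  X ^+ k = 0 -> (X + Y) ^+ k = 0 -> mxexp (X + Y) *m h = mxexp X *m h.
Proof.
move=> XY Yh Xk XYk; rewrite (mxexpE Xk) (mxexpE XYk).
exact: (power_sum_mulmx_add (fun m => m`!%:R^-1)).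
Qed.

End NilpotentSeries.

Lemma big_ord_first_last (V : nmodType) (n k : nat) (hk : (k <= n)%N) (F : 'I_n -> V) :
  \sum_i F i = \sum_(s < k) F (first_ord hk s) + \sum_(i < n - k) F (last_ord hk i).
Proof.
rewrite (reindex (cast_ord (subnKC hk)))/=; last first.
  apply: onW_bij; exists (cast_ord (esym (subnKC hk))) => i.
    by rewrite cast_ordK.
  by rewrite cast_ordKV.
rewrite big_split_ord /=; congr (_ + _); apply: eq_bigr => i _; congr F.
exact: val_inj.
Qed.

(** * The logarithms of the monodromy matrices *)

Section Logarithms.
Context (R : realType) (n d : nat) (T : 'I_n -> 'M[int]_d).
Hypothesis T_aut : forall j, T j \in unitmx.
Hypothesis T_comm : forall i j, T i *m T j = T j *m T i.
Hypothesis T_unip : forall j, unipotent_mx (T j).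
Local Notation C := (cplx R).
Local Notation N := (Nlog R T).

Lemma toCM m p q (A : 'M[int]_(m, p)) (B : 'M[int]_(p, q)) :
  toC R (A *m B) = toC R A *m toC R B.
Proof. exact: (map_mxM (intmul (1 : C))). Qed.

Lemma toC1 m : toC R (1%:M : 'M[int]_m) = 1%:M.
Proof. exact: (map_mx1 (intmul (1 : C))). Qed.

Lemma toCB m p (A B : 'M[int]_(m, p)) : toC R (A - B) = toC R A - toC R B.
Proof. exact: (map_mxB (intmul (1 : C))). Qed.

Lemma toCX m (A : 'M[int]_m) j : toC R (A ^+ j) = toC R A ^+ j.
Proof.
elim: j => [|j IH]; first by rewrite !expr0; exact: toC1.
by rewrite !exprS -[in LHS]mulmxE toCM IH.
Qed.

Lemma toC_prod m (I : Type) (r : seq I) (A : I -> 'M[int]_m) :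
  toC R (\prod_(i <- r) A i) = \prod_(i <- r) toC R (A i).
Proof.
elim: r => [|i r IH]; first by rewrite !big_nil; exact: toC1.
by rewrite !big_cons -[in LHS]mulmxE toCM IH.
Qed.

Lemma toC_comm i j : GRing.comm (toC R (T i)) (toC R (T j)).
Proof. by rewrite /GRing.comm -!mulmxE -!toCM T_comm. Qed.

Lemma unipotent_uniform : exists K, forall j, (1 - toC R (T j)) ^+ K = 0.
Proof.
have /choice[K HK] : forall j, exists m, (T j - 1%:M) ^+ m = 0 by exact: T_unip.
exists (\sum_j K j)%N => j; apply: (@expr_ge_eq0 _ _ _ (K j)).
  rewrite -opprB exprNn -[X in _ - X]/(1%:M) -toC1 -toCB -toCX HK.
  have -> : toC R (0 : 'M[int]_d) = 0 by apply/matrixP => a b; rewrite !mxE.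
  by rewrite mulr0.
by rewrite (bigD1 j)//= leq_addr.
Qed.

Lemma comm_1B (x y : 'M[C]_d) : GRing.comm x y -> GRing.comm (1 - x) (1 - y).
Proof.
move=> xy; apply: commrB; first exact: commr1.
by apply/commr_sym; apply: commrB; [exact: commr1|exact/commr_sym].
Qed.

Lemma Nlog_comm i j : GRing.comm (N i) (N j).
Proof.
have [K HK] := unipotent_uniform; rewrite /Nlog !(neglogE (HK _)).
apply: commr_sum => b _; apply: comm_scale; apply/commr_sym.
apply: commr_sum => a _; apply: comm_scale.
apply: commrX; apply/commr_sym/commrX; apply: comm_1B; exact: toC_comm.
Qed.

(** The logarithm series has the nilpotent factor 1 - T_j, which commutes with the cofactor. *)
Lemma Nlog_nilpotent : exists K, forall j, N j ^+ K = 0.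
Proof.
have [K HK] := unipotent_uniform; exists K => j; rewrite /Nlog (neglogE (HK j)).
set X := 1 - _.
have -> : \sum_(m < K) m.+1%:R^-1 *: X ^+ m.+1 = X * \sum_(m < K) m.+1%:R^-1 *: X ^+ m.
  rewrite mulr_sumr; apply: eq_bigr => m _.
  by rewrite exprS -!mulmxE -scalemxAr.
rewrite exprMn_comm ?HK ?mul0r//.
by apply: commr_sum => m _; apply: comm_scale; apply: commrX.
Qed.

(** One exponent serves all [z], so that the exponential of the combination is a polynomial in [z]
    of bounded degree. *)
Lemma Nlog_comb_nilpotent : exists K, forall z : 'I_n -> C,
  (\sum_j z j *: N j) ^+ K = 0.
Proof.
have [K HK] := Nlog_nilpotent; exists (size (index_enum 'I_n) * K).+1 => z.
apply: nilpotent_sum => [i j|i]; last by rewrite expr_scale HK scaler0.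
by apply: comm_scale; apply/commr_sym; apply: comm_scale; exact: Nlog_comm.
Qed.

Definition int_pos (a : int) : nat := if a is Posz m then m else 0%N.
Definition int_neg (a : int) : nat := if a is Negz m then m.+1 else 0%N.

(** All powers of the positive and of the negative part of T^a agree on [h]. Hence so do the linear
    coefficients of their exponent polynomials, whose difference is the combination of the N_i up to
    sign. *)
Lemma stabilizer_log (h : 'cV[int]_d) a : stabilizer T h a ->
  (\sum_i (a i 0)%:~R *: N i) *m toC R h = 0.
Proof.
rewrite /stabilizer /= => Uh.
(* T^a = V W^-1, so that only natural powers have to be compared. *)
pose V := \prod_i T i ^+ int_pos (a i 0); pose W := \prod_i T i ^+ int_neg (a i 0).
have cT i j : GRing.comm (T i) (T j) by rewrite /GRing.comm -!mulmxE T_comm.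
have cVW : GRing.comm V W.
  apply: commr_prod => i _; apply/commr_sym; apply: commr_prod => j _.
  by apply: commrX; apply/commr_sym; apply: commrX.
have cinv i j : GRing.comm (invmx (T i)) (T j).
  rewrite /GRing.comm -!mulmxE -[LHS]mulmx1 -{1}(mulmxV (T_aut i)) !mulmxA.
  rewrite -[invmx (T i) *m T j *m T i]mulmxA T_comm mulmxA mulVmx// mul1mx.
  by [].
have VW : V *m h = W *m h.
  rewrite -{2}Uh mulmxA [W *m _](_ : _ = V)//.
  have cTW i j : GRing.comm (mxpowz (T i) (a i 0)) (T j ^+ int_neg (a j 0)).
    apply: commrX; case: (a i 0) => m; apply/commr_sym; apply: commrX => //.
    exact/commr_sym.
  rewrite mulmxE -[LHS](_ : (\prod_i mxpowz (T i) (a i 0)) * W = _); last first.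
    apply: commr_prod => j _; apply/commr_sym; apply: commr_prod => i _.
    exact/commr_sym.
  rewrite -prodrM_comm => [|i j _ _]; last exact: cTW.
  apply: eq_bigr => i _; case: (a i 0) => m /=; first by rewrite mulr1.
  have ci : GRing.comm (invmx (T i)) (T i) by exact: cinv.
  by rewrite -exprMn_comm// -mulmxE mulVmx// expr1n.
have VWN j : V ^+ j *m h = W ^+ j *m h.
  elim: j => [|j IH]; first by rewrite !expr0.
  rewrite exprSr exprS -!mulmxE -mulmxA VW mulmxA [V ^+ j *m W](_ : _ = W *m V ^+ j).
    by rewrite -mulmxA IH mulmxA.
  by rewrite mulmxE; apply/commr_sym; apply: commrX; exact/commr_sym.
have [K HK] := unipotent_uniform.
have lT j : power_poly (toC R (T j)) (- N j).
  by rewrite /Nlog (neglogE (HK j)); exact: power_poly_unipotent.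
have lP (c : 'I_n -> nat) :
    power_poly (toC R (\prod_i T i ^+ c i)) (\sum_i (c i)%:R *: - N i).
  rewrite toC_prod (eq_bigr (fun i => toC R (T i) ^+ c i)); last first.
    by move=> i _; rewrite toCX.
  apply: power_poly_prod => [i j|i]; last exact: power_polyX.
  by apply: commrX; apply/commr_sym; apply: commrX; exact: toC_comm.
have := power_poly_vec (lP (fun i => int_pos (a i 0))) (lP (fun i => int_neg (a i 0))).
move=> /(_ (toC R h)) E; have {}E := E _; apply/eqP.
have /E/eqP : forall j, toC R V ^+ j *m toC R h = toC R W ^+ j *m toC R h.
  by move=> j; rewrite -!toCX -!toCM VWN.
rewrite -subr_eq0 -mulmxBl -sumrB -oppr_eq0 -mulNmx -sumrN => /eqP H.
apply/eqP; rewrite -[RHS]H; congr (_ *m _); apply: eq_bigr => i _.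
rewrite -scalerBl scalerN opprK; congr (_ *: _).
case: (a i 0) => m /=; first by rewrite subr0.
by rewrite NegzE mulrNz sub0r.
Qed.

End Logarithms.

(** * The sheet and its equations *)

Section DifferentiableCalculus.
Context (R : realType) (V : normedModType (cplx R)).
Local Notation C := (cplx R).

Lemma differentiable_meval m (q : mpoly.mpoly m C) (F : 'I_m -> V -> C) x :
  (forall i, differentiable (F i) x) ->
  differentiable (fun y => mpoly.meval (fun i => F i y) q) x.
Proof.
move=> dF; apply: differentiable_bigsum => u.
apply: differentiable_mul;
    first exact: differentiable_cst.
by apply: differentiable_bigprod => i; exact: differentiable_exp.
Qed.

Lemma differentiable_mx_exp m (X : V -> 'M[C]_m) x j :
  (forall a b, differentiable (fun y => X y a b) x) ->
  forall a b, differentiable (fun y => (X y ^+ j) a b) x.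
Proof.
move=> dX; elim: j => [|j IH] a b; first exact: differentiable_cst.
rewrite (_ : (fun y => _) = fun y => \sum_l X y a l * (X y ^+ j) l b); last first.
  by apply/funext => y; rewrite exprS -mulmxE mxE.
by apply: differentiable_bigsum => l; exact: differentiable_mul.
Qed.

(** The nilpotency order is uniform in the point, so the exponential is a fixed polynomial in the
    entries. *)
Lemma differentiable_nilpotent_exp m K (X : V -> 'M[C]_m) (h : 'cV[C]_m) x :
  (forall y, X y ^+ K = 0) -> (forall a b, differentiable (fun y => X y a b) x) ->
  forall l, differentiable (fun y => (mxexp (X y) *m h) l 0) x.
Proof.
move=> XK dX l.
rewrite (_ : (fun y => _) =
    fun y => \sum_a (\sum_(j < K) j`!%:R^-1 * (X y ^+ j) l a) * h a 0); last first.
  apply/funext => y; rewrite (mxexpE (XK y)) mxE; apply: eq_bigr => a _.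
  by rewrite summxE; congr (_ * _); apply: eq_bigr => j _; rewrite mxE.
apply: differentiable_bigsum => a; apply: differentiable_mul;
  last exact: differentiable_cst.
apply: differentiable_bigsum => j; apply: differentiable_mul;
    first exact: differentiable_cst.
exact: differentiable_mx_exp.
Qed.

Lemma differentiable_comp_cexp (F : V -> C) x :
  differentiable F x -> differentiable (fun y => cexp (F y)) x.
Proof. by move=> dF; apply: differentiable_comp => //; exact: differentiable_cexp. Qed.

End DifferentiableCalculus.

Section SheetEquations.
Context (R : realType) (n d : nat) (T : 'I_n -> 'M[int]_d).
Hypothesis T_aut : forall j, T j \in unitmx.
Hypothesis T_comm : forall i j, T i *m T j = T j *m T i.
Hypothesis T_unip : forall j, unipotent_mx (T j).
Context (h : 'cV[int]_d) (k : nat) (hk : (k <= n)%N) (A : 'M[int]_n).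
Local Notation C := (cplx R).
Local Notation N := (Nlog R T).
Local Notation M := (Mlog R T A).

Lemma comb_Mlog (I : finType) (c : I -> C) (g : I -> 'I_n) :
  \sum_s c s *: M (g s) = \sum_i (\sum_s c s * (A i (g s))%:~R) *: N i.
Proof.
under eq_bigr do rewrite /Mlog scaler_sumr.
rewrite exchange_big /=; apply: eq_bigr => i _.
by rewrite scaler_suml; apply: eq_bigr => s _; rewrite scalerA.
Qed.

Lemma Nlog_opp_comb_nilpotent : exists K, forall z : 'I_n -> C,
  (- \sum_j z j *: N j) ^+ K = 0.
Proof.
have [K HK] := Nlog_comb_nilpotent R T_comm T_unip; exists K => z.
by rewrite exprNn HK mulr0.
Qed.

Lemma Mlog_opp_comb_nilpotent : exists K, forall (I : finType) (c : I -> C)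
    (g : I -> 'I_n),
  (- \sum_s c s *: M (g s)) ^+ K = 0.
Proof.
have [K HK] := Nlog_opp_comb_nilpotent; exists K => I c g.
by rewrite comb_Mlog.
Qed.

Context (p : 'I_k -> mpoly.mpoly d C).

Lemma differentiable_evalp s (x : 'rV[C]_n * 'cV[C]_d) :
  differentiable (fun y : 'rV[C]_n * 'cV[C]_d => evalp p y.2 s) x.
Proof.
apply: differentiable_meval => l.
apply: (@differentiable_comp _ _ _ _ snd (fun v : 'cV[C]_d => v l 0)).
  exact: differentiable_snd.
exact: differentiable_coord.
Qed.

Lemma differentiable_eq_exp l (x : 'rV[C]_n * 'cV[C]_d) :
  differentiable (eq_exp T h A hk p l) x.
Proof.
apply: (@differentiableB _ _ _ (fun y : 'rV[C]_n * 'cV[C]_d => y.2 l 0)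
   (fun y => expM T h A hk (evalp p y.2) l 0)).
  apply: (@differentiable_comp _ _ _ _ snd (fun v : 'cV[C]_d => v l 0)).
    exact: differentiable_snd.
  exact: differentiable_coord.
have [K HK] := Mlog_opp_comb_nilpotent.
apply: (@differentiable_nilpotent_exp _ _ _ K
  (fun y : 'rV[C]_n * 'cV[C]_d =>
     - \sum_(s < k) evalp p y.2 s *: M (first_ord hk s))) => [y|a b].
  exact: HK.
rewrite (_ : (fun y => _) = fun y : 'rV[C]_n * 'cV[C]_d =>
    - \sum_(s < k) evalp p y.2 s * M (first_ord hk s) a b); last first.
  by apply/funext => y; rewrite mxE summxE; congr (- _);
    apply: eq_bigr => s _; rewrite mxE.
apply: differentiableN; apply: differentiable_bigsum => s.
by apply: differentiable_mul; [exact: differentiable_evalp|exact: differentiable_cst].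
Qed.

Lemma differentiable_eq_mon (q : mpoly.mpoly n C) (x : 'rV[C]_n * 'cV[C]_d) :
  differentiable (eq_mon A hk p q) x.
Proof.
apply: differentiable_meval => j; apply: differentiable_mul.
  apply: (@differentiable_comp _ _ _ _ fst (fun v : 'rV[C]_n => v 0 j)).
    exact: differentiable_fst.
  exact: differentiable_coord.
apply: differentiable_comp_cexp; apply: differentiableN.
apply: differentiable_mul;
    first exact: differentiable_cst.
apply: differentiable_bigsum => s; apply: differentiable_mul;
    first exact: differentiable_cst.
exact: differentiable_evalp.
Qed.

Lemma differentiable_sheet_map z : differentiable (fun z : 'rV[C]_n => sheet_map T z h) z.
Proof.
apply: differentiable_pair.
  apply: differentiable_matrix => i j.
  rewrite (_ : (fun y => _) = fun y : 'rV[C]_n => cexp (twopii R * y 0 j)); last first.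
    by apply/funext => y; rewrite mxE.
  apply: differentiable_comp_cexp; apply: differentiable_mul;
    first exact: differentiable_cst.
  exact: differentiable_coord.
apply: differentiable_matrix => i j; rewrite ord1.
have [K HK] := Nlog_opp_comb_nilpotent.
apply: (@differentiable_nilpotent_exp _ _ _ K
  (fun y : 'rV[C]_n => - \sum_j y 0 j *: N j)) => [y|a b]; first exact: HK.
rewrite (_ : (fun y => _) = fun y : 'rV[C]_n => - \sum_s y 0 s * N s a b); last first.
  by apply/funext => y; rewrite mxE summxE; congr (- _);
    apply: eq_bigr => s _; rewrite mxE.
apply: differentiableN; apply: differentiable_bigsum => s.
by apply: differentiable_mul; [exact: differentiable_coord|exact: differentiable_cst].
Qed.

End SheetEquations.

Lemma closure_zero (R : realType) (V : normedModType (cplx R)) (S : set V)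
    (g : V -> cplx R) (x : V) :
  differentiable g x -> (forall y, S y -> g y = 0) -> closure S x -> g x = 0.
Proof.
move=> /differentiable_continuous cg g0 Sx; apply/eqP/negPn/negP => gx.
have gx0 : 0 < `|g x| by rewrite normr_gt0.
move/cvgrPdist_lt: cg => /(_ _ gx0) /Sx[y [/g0 gy /=]].
by rewrite gy subr0 ltxx.
Qed.

Lemma open_ambient (R : realType) n d : open (ambient R n d).
Proof.
rewrite openE => x xa; rewrite /interior.
apply: (@filter_forall _ _ (fun j => [set y : 'rV[cplx R]_n * 'cV[cplx R]_d |
  `|y.1 0 j| < 1]) (nbhs x) (nbhs_filter x)) => j.
have cj : {for x, continuous (fun y : 'rV[cplx R]_n * 'cV[cplx R]_d => y.1 0 j)}.
  apply: (@continuous_comp _ _ _ fst (fun v : 'rV[cplx R]_n => v 0 j)).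
    exact: cvg_fst.
  exact: coord_continuous.
have j1 : 0 < 1 - `|x.1 0 j| by rewrite subr_gt0; exact: xa.
move/cvgrPdist_lt: cj => /(_ _ j1); apply: filterS => y /= hy.
rewrite -(subKr (x.1 0 j) (y.1 0 j)); apply: le_lt_trans (ler_normB _ _) _.
by rewrite addrC -ltrBrDr.
Qed.

Lemma extend_first_last (T : Type) n k (hk : (k <= n)%N)
    (a : 'I_k -> T) (b : 'I_(n - k) -> T) :
  exists w : 'I_n -> T, (forall s, w (first_ord hk s) = a s) /\
                        (forall i, w (last_ord hk i) = b i).
Proof.
exists (fun l => match fintype.split (cast_ord (esym (subnKC hk)) l) with
                 | inl s => a s | inr i => b i end); split=> s.
  rewrite (_ : cast_ord _ _ = unsplit (inl s)) ?unsplitK//; exact: val_inj.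
by rewrite /last_ord cast_ordK (_ : rshift k s = unsplit (inr s)) ?unsplitK.
Qed.

(** * The closure of the sheet as the solution set of the equations *)

Section SheetClosure.
Context (R : realType) (n d : nat) (T : 'I_n -> 'M[int]_d).
Hypothesis T_aut : forall j, T j \in unitmx.
Hypothesis T_comm : forall i j, T i *m T j = T j *m T i.
Hypothesis T_unip : forall j, unipotent_mx (T j).
Context (h : 'cV[int]_d) (k : nat) (hk : (k <= n)%N) (A : 'M[int]_n).
Hypothesis A_det : \det A = 1.
Hypothesis A_basis : Zbasis (stabilizer T h) (fun i => col (last_ord hk i) A).
Local Notation C := (cplx R).
Local Notation N := (Nlog R T).
Local Notation M := (Mlog R T A).

(** The last columns of [A] are basis vectors of the stabilizer, and [stabilizer_log] makes this a
    linear relation. *)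
Lemma Mlog_last i : M (last_ord hk i) *m toC R h = 0.
Proof.
have /(stabilizer_log R T_aut T_comm T_unip) H : stabilizer T h (col (last_ord hk i) A).
  apply/A_basis.1; exists (fun j => (j == i)%:R).
  rewrite (bigD1 i)//= eqxx scale1r big1 ?addr0// => j /negPf ->.
  by rewrite scale0r.
rewrite -[RHS]H; congr (_ *m _); apply: eq_bigr => j _.
by rewrite mxE.
Qed.

Lemma Mlog_comm i j : GRing.comm (M i) (M j).
Proof.
apply: commr_sum => b _; apply: comm_scale; apply/commr_sym.
by apply: commr_sum => a _; apply: comm_scale; exact: Nlog_comm.
Qed.

Lemma mxexp_coords (w : 'I_n -> C) :
  mxexp (- \sum_j (\sum_l w l * (A j l)%:~R) *: N j) *m toC R h =
  expM T h A hk (fun s => w (first_ord hk s)).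
Proof.
rewrite -(comb_Mlog T A w id) (big_ord_first_last hk) /expM.
have [K HK] := Mlog_opp_comb_nilpotent R T_comm T_unip A.
set X := \sum_(s < k) _; set Y := \sum_(i < n - k) _.
have XY0 : (- X + - Y) ^+ K = 0.
  by rewrite -opprD /X /Y -(big_ord_first_last hk (fun l => w l *: M l)); exact: HK.
rewrite opprD; apply: (mxexp_mulmx_add (k := K)) => //; last exact: HK.
  apply: commrN; apply/commr_sym; apply: commrN; apply/commr_sym.
  apply: commr_sum => i _; apply: comm_scale; apply/commr_sym.
  by apply: commr_sum => s _; apply: comm_scale; exact: Mlog_comm.
rewrite mulNmx mulmx_suml big1 ?oppr0// => i _.
by rewrite -scalemxAl Mlog_last scaler0.
Qed.

(** Since [A] has determinant 1, its adjugate is its inverse. *)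
Lemma coords_surj (z : 'I_n -> C) :
  exists w : 'I_n -> C, forall j, z j = \sum_l w l * (A j l)%:~R.
Proof.
pose W := toC R (\adj A) *m \col_j z j.
exists (fun l => W l 0) => j.
have : toC R A *m W = \col_j z j by rewrite mulmxA -toCM mul_mx_adj A_det toC1 mul1mx.
move=> /matrixP/(_ j 0); rewrite !mxE => <-; apply: eq_bigr => l _.
by rewrite !mxE mulrC.
Qed.

(** Separates the monomial in the last n - k coordinates from the factor that the rescaling in
    [eq_mon] removes; integrality of [A] turns coefficients into exponents. *)
Lemma cexp_coords (w : 'I_n -> C) (j : 'I_n) :
  cexp (twopii R * \sum_l w l * (A j l)%:~R) =
  (\prod_(i < n - k) cexp (twopii R * w (last_ord hk i)) ^ A j (last_ord hk i)) *
  cexp (twopii R * \sum_(s < k) (A j (first_ord hk s))%:~R * w (first_ord hk s)).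
Proof.
rewrite (big_ord_first_last hk) mulrDr cexpD mulrC; congr (_ * _).
  rewrite mulr_sumr cexp_sum; apply: eq_bigr => i _.
  by rewrite -cexp_int mulrA mulrC.
by congr (cexp (_ * _)); apply: eq_bigr => s _; rewrite mulrC.
Qed.

Lemma twopii_neq0 : twopii R != 0.
Proof. by rewrite -cabs_eq0 cabs_twopii mulf_neq0// gt_eqF// pi_gt0. Qed.

Lemma cexp_twopii_lt1 (z : C) :
  (`|cexp (twopii R * z)| < 1) = (0 < complex.Im (z : R[i])).
Proof.
rewrite normE -(rmorph1 (@ofR R)) ofR_lt cabs_cexp expR_lt1.
case: z => a b /=; rewrite mul0r sub0r oppr_lt0 pmulr_rgt0//.
by rewrite mulr_gt0// pi_gt0.
Qed.

Lemma sheet_sub_ambient : sheet R T h `<=` ambient R n d.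
Proof. by move=> _ [z zH <-] j /=; rewrite mxE cexp_twopii_lt1. Qed.

Context (p : 'I_k -> mpoly.mpoly d C).
Hypothesis p_inv : forall (w : 'I_k -> C) (v : 'cV[C]_d),
  v = expM T h A hk w -> forall s, w s = evalp p v s.
Context (e : nat) (f : 'I_e -> mpoly.mpoly n C).
Hypothesis f_zero : [set x : 'rV[C]_n |
    forall b, mpoly.meval (fun j => x 0 j) (f b) = 0] =
  closure (monomial_image R A hk).

Lemma sheet_equations x : sheet R T h x ->
  (forall l, eq_exp T h A hk p l x = 0) /\ (forall b, eq_mon A hk p (f b) x = 0).
Proof.
move=> [z _ <-]; have [w zw] := coords_surj (fun j => z 0 j).
set x' := sheet_map T z h.
have x1 j : x'.1 0 j = cexp (twopii R * \sum_l w l * (A j l)%:~R) by rewrite mxE zw.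
have x2 : x'.2 = expM T h A hk (fun s => w (first_ord hk s)).
  have zN : \sum_j z 0 j *: N j = \sum_j (\sum_l w l * (A j l)%:~R) *: N j.
    by apply: eq_bigr => j _; rewrite -zw.
  by rewrite -mxexp_coords -zN.
have pw := p_inv x2; split=> [l|b].
  by rewrite /eq_exp {1}x2 -(funext pw) subrr.
pose y : 'rV[C]_n := \row_j \prod_(i < n - k)
  cexp (twopii R * w (last_ord hk i)) ^ A j (last_ord hk i).
have : closure (monomial_image R A hk) y.
  apply: subset_closure; exists (fun i => cexp (twopii R * w (last_ord hk i))).
  split; [move=> i; exact: cexp_neq0|reflexivity].
rewrite -f_zero /= => /(_ b) fy; rewrite /eq_mon -[RHS]fy; apply: mpoly.meval_eq => j.
rewrite x1 cexp_coords mxE -(funext pw) cexpN mulfK ?cexp_neq0//.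
Qed.

Lemma sheet_closureE : sheet_closure R T h =
  [set x | [/\ ambient R n d x, forall l, eq_exp T h A hk p l x = 0 &
               forall b, eq_mon A hk p (f b) x = 0]].
Proof.
apply/seteqP; split=> [x [cx ax]|[t v] [ax ex mx]].
  split=> // [l|b].
    apply: closure_zero cx; first exact: differentiable_eq_exp.
    by move=> y /sheet_equations[].
  apply: closure_zero cx; first exact: differentiable_eq_mon.
  by move=> y /sheet_equations[].
split=> //.
have vE : v = expM T h A hk (evalp p v).
  apply/matrixP => l j; rewrite ord1; apply/eqP; rewrite -subr_eq0.
  by apply/eqP; exact: ex.
pose E j := cexp (twopii R * \sum_(s < k) (A j (first_ord hk s))%:~R * evalp p v s).
pose y0 : 'rV[C]_n := \row_j (t 0 j * (E j)^-1).
have y0c : closure (monomial_image R A hk) y0.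
  rewrite -f_zero /= => b; rewrite -[RHS](mx b) /eq_mon; apply: mpoly.meval_eq => j.
  by rewrite mxE /= cexpN.
(* [G] undoes the rescaling with [v] fixed, so that points of the monomial image near [y0] give
   points near the solution (t, v). *)
pose G (y : 'rV[C]_n) : 'rV[C]_n * 'cV[C]_d := (\row_j (y 0 j * E j), v).
have Gy0 : G y0 = (t, v).
  congr pair; apply/matrixP => i j; rewrite ord1 !mxE divfK//; exact: cexp_neq0.
have cG : G y @[y --> y0] --> G y0.
  apply: differentiable_continuous; apply: differentiable_pair;
    last exact: differentiable_cst.
  apply: differentiable_matrix => i j.
  rewrite (_ : (fun y => _) = fun y : 'rV[C]_n => y 0 j * E j); last first.
    by apply/funext => y; rewrite mxE.
  by apply: differentiable_mul; [exact: differentiable_coord|exact: differentiable_cst].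
move=> B nB.
(* Staying inside the polydisc guarantees that the approximating point comes from the upper
   half-plane. *)
have nBa : nbhs (G y0) (B `&` ambient R n d).
  rewrite Gy0; apply: filterI => //; apply: open_nbhs_nbhs; split=> //.
  exact: open_ambient.
have [y [[u [u0 yu]] [By ay]]] := y0c _ (cG _ nBa).
have /choice[om Hom] : forall i, exists c, cexp (twopii R * c) = u i.
  move=> i; have [c cE] := cexp_surj (u0 i); exists (c / twopii R).
  by rewrite mulrC divfK// twopii_neq0.
(* The first k coordinates are prescribed by [v], the last n - k are normalized logarithms of the
   u_i. *)
have [w [w1 w2]] := extend_first_last hk (evalp p v) om.
pose z : 'rV[C]_n := \row_j \sum_l w l * (A j l)%:~R.
have w1' : (fun s => w (first_ord hk s)) = evalp p v by apply/funext.
have yE j : (G y).1 0 j = cexp (twopii R * z 0 j).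
  rewrite !mxE cexp_coords yu mxE; congr (_ * _).
    by apply: eq_bigr => i _; rewrite w2 Hom.
  by congr (cexp (_ * _)); apply: eq_bigr => s _; rewrite w1.
exists (G y); split=> //; exists z.
  by move=> j; rewrite -cexp_twopii_lt1 -yE; exact: ay.
rewrite /sheet_map [RHS]surjective_pairing; congr pair.
  by apply/matrixP => i j; rewrite ord1 yE mxE.
have zN : \sum_j z 0 j *: N j = \sum_j (\sum_l w l * (A j l)%:~R) *: N j.
  by apply: eq_bigr => j _; rewrite mxE.
by rewrite zN mxexp_coords w1' -vE.
Qed.

End SheetClosure.

(** * Irreducibility *)

Section RealNorm.
Context (R : realType) (V : normedModType (cplx R)).
Implicit Types x y : V.

Definition rnorm x : R := complex.Re (`|x| : R[i]).

Lemma rnormE x : `|x| = ofR (rnorm x).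
Proof.
have [->|x0] := eqVneq x 0; first by rewrite /rnorm normr0 rmorph0.
have /gt0_ofR[r _ E] : 0 < `|x| by rewrite normr_gt0.
by rewrite /rnorm E.
Qed.

Lemma rnormD x y : rnorm (x + y) <= rnorm x + rnorm y.
Proof. by rewrite -ofR_le rmorphD /= -!rnormE ler_normD. Qed.

Lemma rnorm_ge0 x : 0 <= rnorm x.
Proof. by rewrite -ofR_le rmorph0 -rnormE. Qed.

Lemma rnormZ (c : cplx R) x : rnorm (c *: x) = cabs c * rnorm x.
Proof. by have := normrZ c x; rewrite !rnormE normE -rmorphM /= => -[]. Qed.

Lemma rnormB x y : rnorm (x - y) = rnorm (y - x).
Proof. by rewrite /rnorm distrC. Qed.

Lemma near_rnorm x (P : V -> Prop) :
  (\forall y \near x, P y) <->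
  exists2 r : R, 0 < r & forall y, rnorm (y - x) < r -> P y.
Proof.
split=> [/nbhs_normP[e /= /gt0_ofR[r r0 ->] H]|[r r0 H]].
  by exists r => // w wr; apply: H; rewrite /= distrC rnormE ofR_lt.
apply/nbhs_normP; exists (ofR r) => /=; first by rewrite -(rmorph0 (@ofR R)) ofR_lt.
by move=> w /=; rewrite distrC rnormE ofR_lt; exact: H.
Qed.

End RealNorm.

(** Analytic subsets are relatively closed: near a limit point the local equations are continuous
    and pass to the limit. *)
Lemma analytic_closure (R : realType) (V : normedModType (cplx R))
    (Omega Y : set V) x :
  analytic_subset Omega Y -> Omega x -> closure Y x -> Y x.
Proof.
move=> [_ aY] Ox cY; have [W [oW Wx _ [m [g [dg E]]]]] := aY x Ox.
suff : (Y `&` W) x by case.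
rewrite E; split=> // i; apply: (closure_zero (S := Y `&` W)).
- exact: dg.
- by rewrite E => y [_].
- move=> B nB; have [|y [Yy [By Wy]]] := cY (B `&` W).
    by apply: filterI => //; exact: open_nbhs_nbhs.
  by exists y.
Qed.

Section Propagation.
Context (R : realType) (U V : normedModType (cplx R)).
Local Notation C := (cplx R).
Implicit Types (H : set U) (Omega Z : set V) (phi : U -> V).

(* The identity theorem on the complex line through a point near which the
   pulled-back equations vanish. *)
Lemma analytic_preimage_interior H Omega Z phi (x : U) :
  open H -> (forall z, H z -> differentiable phi z /\ Omega (phi z)) ->
  analytic_subset Omega Z -> H x ->
  closure ((phi @^-1` Z)^°)%classic x -> ((phi @^-1` Z)^°)%classic x.
Proof.
move=> oH Hphi [_ aZ] Hx cx.
have [W [oW Wx _ [m [g [dg E]]]]] := aZ _ (Hphi x Hx).2.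
have cphi : phi z @[z --> x] --> phi x.
  by apply: differentiable_continuous; exact: (Hphi x Hx).1.
have nH : nbhs x H by exact: open_nbhs_nbhs.
have nW : nbhs x (phi @^-1` W) by apply: cphi; exact: open_nbhs_nbhs.
have nB : nbhs x (fun z => forall i, cabs (g i (phi z)) <= cabs (g i (phi x)) + 1).
  apply: (@filter_forall _ _ (fun i z => cabs (g i (phi z)) <= cabs (g i (phi x)) + 1)
    (nbhs x) (nbhs_filter x)) => i.
  have cg : g i (phi z) @[z --> x] --> g i (phi x).
    by apply: (@continuous_comp _ _ _ phi (g i)) => //;
      apply/differentiable_continuous/dg.
  have /cvgrPdist_lt/(_ 1 ltr01) := cg; apply: filterS => z.
  rewrite normE -(rmorph1 (@ofR R)) ofR_lt => h.
  rewrite -(subKr (g i (phi x)) (g i (phi z))).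
  by apply: le_trans (cabsD _ _) _; rewrite cabsN lerD2l ltW.
have [e e0 He] := (near_rnorm _ _).1 (filterI nH (filterI nW nB)).
have e8 : 0 < e / 8 by rewrite divr_gt0.
have [|x' [Px' xx']] := cx (fun z => rnorm (z - x) < e / 8).
  by apply/near_rnorm; exists (e / 8).
have [r r0 Hr] := (near_rnorm _ _).1 Px'.
apply/near_rnorm; exists (e / 8) => // z zx.
pose rho := rnorm (z - x').
have rho0 : 0 <= rho by exact: rnorm_ge0.
have rhoe : rho < e / 4.
  rewrite /rho; have -> : z - x' = (z - x) + (x - x') by rewrite addrA subrK.
  apply: le_lt_trans (rnormD _ _) _; rewrite (rnormB x x'); lra.
(* The factor 2 places [z] at the parameter 1/2, strictly inside the unit disc. The disc stays
   within e of [x] because e/8 + 2 (e/4) < e. *)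
pose l (c : C) := x' + (2 * c) *: (z - x').
have le c : cabs c <= 1 -> rnorm (l c - x) < e.
  move=> c1; have -> : l c - x = (x' - x) + (2 * c) *: (z - x') by rewrite /l addrAC.
  apply: le_lt_trans (rnormD _ _) _; rewrite rnormZ cabsM cabs_nat -/rho.
  have := cabs_ge0 c; have : cabs c * rho <= rho by rewrite ler_piMl.
  lra.
(* For small parameters the line stays in the ball around [x'] that maps into [Z]. Taking rho + 1
   covers the case z = x'. *)
have lr c : cabs c < r / (2 * (rho + 1)) -> rnorm (l c - x') < r.
  rewrite ltr_pdivlMr ?mulr_gt0 ?ltr_wpDl// => cr.
  rewrite /l addrAC subrr add0r rnormZ cabsM cabs_nat -/rho.
  have := cabs_ge0 c; nra.
suff : (Z `&` W) (phi z) by case.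
have l2 : l 2^-1 = z by rewrite /l divff ?pnatr_eq0// scale1r addrC subrK.
have h1 : cabs (2^-1 : C) < 1 by rewrite cabsV cabs_nat invf_lt1// ltr1n.
have [_ [Wz _]] := He z ltac:(by rewrite -l2; apply/le/ltW).
rewrite E; split=> // i; rewrite -l2.
pose rr := Num.min 1 (r / (2 * (rho + 1))).
have rr0 : 0 < rr by rewrite lt_min ltr01 divr_gt0// mulr_gt0// ltr_wpDl.
apply: (@vanishing_disc _ (fun c => g i (phi (l c))) (cabs (g i (phi x)) + 1) rr) => //.
- move=> c c1; have [Hl [Wl _]] := He _ (le c c1).
  apply: (@differentiable_comp _ _ _ _ (fun c => phi (l c)) (g i)); last exact: dg.
  apply: (@differentiable_comp _ _ _ _ l phi); last exact: (Hphi _ Hl).1.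
  apply: differentiable_add; first exact: differentiable_cst.
  apply: differentiableZl; apply: differentiable_mul; first exact: differentiable_cst.
  by [].
- by move=> c c1; have [_ [_]] := He _ (le c c1); apply.
- move=> c; rewrite lt_min => /andP[c1 cr].
  have [_ [Wl _]] := He _ (le c (ltW c1)).
  have : (Z `&` W) (phi (l c)) by split=> //; exact: Hr (lr c cr).
  by rewrite E => -[_]; apply.
Qed.

Lemma continuous_segment (x v : U) : continuous (fun s : R => x + ofR s *: v).
Proof.
move=> s; apply: (@continuous_comp _ _ _ (@ofR R) (fun c : C => x + c *: v)).
  apply/cvgrPdist_lt => _ /gt0_ofR[e e0 ->]; apply/nbhs_normP; exists e => //= t.
  by rewrite -rmorphB normE ofR_lt cabs_ofR.
apply: differentiable_continuous; apply: differentiable_add;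
  first exact: differentiable_cst.
by apply: differentiableZl.
Qed.

(** The parameters of the segment lying in [P] form a nonempty, open and closed subset of the
    connected interval [0, 1]. *)
Lemma segment_propagation H (P : set U) (x y : U) :
  (forall z, H z -> closure P z -> P z) -> open P -> P x ->
  (forall s : R, 0 <= s <= 1 -> H (x + ofR s *: (y - x))) -> P y.
Proof.
move=> HP oP Px Hs; pose l (s : R) := x + ofR s *: (y - x).
have cl : continuous l by exact: continuous_segment.
have l0 : l 0 = x by rewrite /l rmorph0 scale0r addr0.
have l1 : l 1 = y by rewrite /l rmorph1 scale1r addrC subrK.
have := @segment_connected R 0 1 (`[0, 1]%classic `&` l @^-1` P) _ _ _.
move=> /(_ _ _ _) E; have {}E : `[0, 1]%classic `&` l @^-1` P = `[0, 1]%classic.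
  apply: E.
  - by exists 0; split; rewrite /= ?l0// in_itv/= lexx ler01.
  - by exists (l @^-1` P) => //; apply: open_comp => // s _; exact: cl.
  - exists (l @^-1` closure P).
      by apply: closed_comp => [s _|]; [exact: cl|exact: closed_closure].
    apply/seteqP; split=> s [s01 ls]; split=> //; first exact: subset_closure.
    by apply: HP => //; apply: Hs; move: s01; rewrite /= in_itv.
have : (`[0, 1]%classic : set R) 1 by rewrite /= in_itv/= lexx ler01.
by rewrite -E => -[_]; rewrite /= l1.
Qed.

End Propagation.

Lemma segment_upper_half (R : realType) n (x y : 'rV[cplx R]_n) :
  upper_half R n x -> upper_half R n y ->
  forall s : R, 0 <= s <= 1 -> upper_half R n (x + ofR s *: (y - x)).
Proof.
move=> Hx Hy s /andP[s0 s1] j; rewrite !mxE.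
have := Hx j; have := Hy j; case: (x 0 j) => a b; case: (y 0 j) => a' b' /= hb' hb.
rewrite mul0r addr0.
nra.
Qed.

Lemma open_upper_half (R : realType) n : open (upper_half R n).
Proof.
rewrite openE => x xa; rewrite /interior.
apply: (@filter_forall _ _ (fun j => [set y : 'rV[cplx R]_n |
  0 < complex.Im (y 0 j : R[i])]) (nbhs x) (nbhs_filter x)) => j.
have /cvgrPdist_lt H : {for x, continuous (fun v : 'rV[cplx R]_n => v 0 j)}.
  exact: coord_continuous.
have xj := xa j; have := H (ofR (complex.Im (x 0 j : R[i]))).
rewrite -(rmorph0 (@ofR R)) ofR_lt => /(_ xj); apply: filterS => y /=.
rewrite normE ofR_lt; move: xj; case: (x 0 j) => a b; case: (y 0 j) => a' b' /= b0.
have [_ [+ _]] := cabs_bounds (a - a') (b - b').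
move=> h1 h2; have := le_lt_trans h1 h2; rewrite ltr_norml => /andP[_]; lra.
Qed.

(** The vanishing ideal is radical, since a complex number with a zero power is zero. *)
Lemma reduced_analyticW (R : realType) (V : normedModType (cplx R))
    (Omega X : set V) : analytic_subset Omega X -> reduced_analytic Omega X.
Proof.
move=> aX; split=> // x _ g m hg [_ gm]; split=> //.
by apply: filterS gm => y gy /gy/eqP; rewrite expf_eq0 => /andP[_ /eqP].
Qed.

Lemma irreducible_image_closure (R : realType) (U V : normedModType (cplx R))
    (H : set U) (Omega : set V) (phi : U -> V) :
  open H -> H !=set0 ->
  (forall x y, H x -> H y ->
     forall s : R, 0 <= s <= 1 -> H (x + ofR s *: (y - x))) ->
  (forall z, H z -> differentiable phi z /\ Omega (phi z)) ->
  analytic_subset Omega (closure (phi @` H) `&` Omega) ->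
  irreducible_analytic Omega (closure (phi @` H) `&` Omega).
Proof.
move=> oH [z0 Hz0] cH Hphi; set X := closure _ `&` _ => aX.
have XH z : H z -> X (phi z).
  move=> Hz; split; last exact: (Hphi z Hz).2.
  by apply: subset_closure; exists z.
split=> //; first by exists (phi z0); exact: XH.
(* An analytic subset containing the image contains its relative closure. *)
have full Z : analytic_subset Omega Z -> (forall z, H z -> Z (phi z)) -> X `<=` Z.
  move=> aZ HZ x [cx Ox]; apply: (analytic_closure aZ Ox).
  by apply: closure_subset cx => _ [z Hz <-]; exact: HZ.
move=> Y Z aY aZ XYZ.
have [HY|] := pselect (forall z, H z -> Y (phi z)).
  by left; apply/seteqP; split; [rewrite XYZ => y; left|exact: full].
move=> /existsNP[z /not_implyP[Hz nY]].
right; apply/seteqP; split; first by rewrite XYZ => y; right.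
apply: full => // y Hy.
(* [Y] is relatively closed, so points near [z] are also mapped outside [Y], hence into [Z]. *)
have nz : ((phi @^-1` Z)^°)%classic z.
  have nzY : \forall w \near z, ~ Y (phi w).
    have cphi : phi w @[w --> z] --> phi z.
      by apply: differentiable_continuous; exact: (Hphi z Hz).1.
    apply: (cphi (~` Y)); apply: contrapT => nn; apply: nY.
    apply: (analytic_closure aY (Hphi z Hz).2) => B nB.
    apply: contrapT => YB; apply: nn; apply: filterS nB => w Bw Yw.
    by apply: YB; exists w.
  have nH : nbhs z H by exact: open_nbhs_nbhs.
  apply: filterS (filterI nzY nH) => w [nYw Hw].
  by have := XH w Hw; rewrite XYZ => -[].
suff : ((phi @^-1` Z)^°)%classic y by move/interior_subset.
apply: (segment_propagation _ _ nz (cH z y Hz Hy)).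
  by move=> w Hw; exact: analytic_preimage_interior oH Hphi aZ Hw.
exact: open_interior.
Qed.

Theorem proposition5 (R : realType) (n d : nat)
  (T : 'I_n -> 'M[int]_d)
  (T_aut : forall j, T j \in unitmx)
  (T_comm : forall i j, T i *m T j = T j *m T i)
  (T_unip : forall j, unipotent_mx (T j))
  (h : 'cV[int]_d)
  (k : nat) (hk : (k <= n)%N)
  (S_rank : free_of_rank (stabilizer T h) (n - k))
  (A : 'M[int]_n)
  (A_det : \det A = 1)
  (A_basis : Zbasis (stabilizer T h) (fun i => col (last_ord hk i) A))
  (p : 'I_k -> mpoly.mpoly d (cplx R))
  (p_inv : forall (w : 'I_k -> cplx R) (v : 'cV[cplx R]_d),
     v = expM T h A hk w -> forall s, w s = evalp p v s)
  (e : nat) (f : 'I_e -> mpoly.mpoly n (cplx R))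
  (f_zero : [set x : 'rV[cplx R]_n |
               forall b, mpoly.meval (fun j => x 0 j) (f b) = 0] =
            closure (monomial_image R A hk)) :
  [/\ forall l : 'I_d,
        holomorphic_on (ambient R n d) (eq_exp T h A hk p l),
      forall b : 'I_e,
        holomorphic_on (ambient R n d) (eq_mon A hk p (f b)),
      sheet_closure R T h =
        [set x | [/\ ambient R n d x,
                     forall l : 'I_d, eq_exp T h A hk p l x = 0 &
                     forall b : 'I_e, eq_mon A hk p (f b) x = 0]],
      reduced_analytic (ambient R n d) (sheet_closure R T h) &
      irreducible_analytic (ambient R n d) (sheet_closure R T h)].
Proof.
have dexp l x : differentiable (eq_exp T h A hk p l) x by exact: differentiable_eq_exp.
have dmon b x : differentiable (eq_mon A hk p (f b)) x by exact: differentiable_eq_mon.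
have E : sheet_closure R T h =
    [set x | [/\ ambient R n d x, forall l, eq_exp T h A hk p l x = 0 &
                 forall b, eq_mon A hk p (f b) x = 0]] by exact: sheet_closureE.
have aX : analytic_subset (ambient R n d) (sheet_closure R T h).
  split=> [x []//|x ax]; exists (ambient R n d); split=> //; first exact: open_ambient.
  (* The equations are global: the whole polydisc serves as the neighbourhood of each of its
     points. *)
  exists (d + e)%N, (fun i => match fintype.split i with
    | inl l => eq_exp T h A hk p l | inr b => eq_mon A hk p (f b) end).
  split=> [i y _|]; first by case: (fintype.split i) => j.
  rewrite E; apply/seteqP; split=> y.
    by move=> [[ay el mb] _]; split=> // i; case: (fintype.split i) => j.
  move=> [ay eqs]; split=> //; split=> // [l|b].
    by have := eqs (unsplit (inl l)); rewrite unsplitK.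
  by have := eqs (unsplit (inr b)); rewrite unsplitK.
split; [by move=> l x _|by move=> b x _|exact: E|exact: reduced_analyticW|].
apply: irreducible_image_closure aX.
- exact: open_upper_half.
- exists (const_mx (Complex 0 1)) => j; rewrite mxE /=; exact: ltr01.
- exact: segment_upper_half.
- move=> z Hz; split; first exact: differentiable_sheet_map.
  by apply: (@sheet_sub_ambient R n d T h); exists z.
Qed.
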